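(* Let $k^+,k^-$ be positive integers. Let $Z^\pm=(X^\pm,Y^\pm)$ be smooth vector fields on a neighborhood $V$ of the origin in $\mathbb{R}^2$, and assume that the Filippov vector field $Z$ equal to $Z^+$ for $y>0$ and to $Z^-$ for $y<0$ has a $(2k^+,2k^-)$-tangential center at the origin. Let $\delta=\operatorname{sign}(X^+(0,0))=-\operatorname{sign}(X^-(0,0))$ and let $T(x)=\delta(T^-(x)-T^+(x))$ be the period function, with $T^\pm$ given by the integral formula in the context. Then $$\widehat T_0:=T(0)=0\qquad\text{and}\qquad \widehat T_1:=T'(0)=2\delta\left(\frac{X^-(0,0)-X^+(0,0)}{X^+(0,0)\,X^-(0,0)}\right)>0 .$$
   Context: The discontinuity manifold of $Z$ is $\Sigma=\{(x,y)\in V: y=0\}$, and trajectories follow Filippov's convention (at points of $\Sigma$ where $Y^+Y^->0$, trajectories of $Z^+$ and $Z^-$ are concatenated). The origin is a $(2k^+,2k^-)$-monodromic tangential singularity of $Z$ if it is an invisible $2k^+$-multiplicity contact of $Z^+$ with $\Sigma$ and an invisible $2k^-$-multiplicity contact of $Z^-$ with $\Sigma$, and $Z$ has a first-return map defined on $\Sigma$ around the origin. (With $h(x,y)=y$, $Fh=\langle\nabla h,F\rangle$ and $F^nh=F(F^{n-1}h)$, an invisible $2k$-multiplicity contact of $Z^\pm$ at $p$ means $(Z^\pm)^ih(p)=0$ for $1\le i\le 2k-1$, with $(Z^+)^{2k}h(p)<0$, resp. $(Z^-)^{2k}h(p)>0$.) This is equivalent to the following three conditions: (C1) $X^\pm(0,0)\ne0$,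 $Y^\pm(0,0)=0$, $\frac{\partial^iY^\pm}{\partial x^i}(0,0)=0$ for $i=1,\dots,2k^\pm-2$, and $\frac{\partial^{2k^\pm-1}Y^\pm}{\partial x^{2k^\pm-1}}(0,0)\neq0$; (C2) $X^+(0,0)\frac{\partial^{2k^+-1}Y^+}{\partial x^{2k^+-1}}(0,0)<0$ and $X^-(0,0)\frac{\partial^{2k^--1}Y^-}{\partial x^{2k^--1}}(0,0)>0$; (C3) $X^+(0,0)X^-(0,0)<0$. The half-return maps $\varphi^+$ and $\varphi^-$ on $\Sigma$ around $0$ are defined by the flows of $Z^+|_{y\ge0}$ and $Z^-|_{y\le0}$: $(\varphi^\pm(x),0)$ is the other endpoint on $\Sigma$ of the arc of trajectory of $Z^\pm$ in $\{\pm y\ge0\}$ having $(x,0)$ as an endpoint (followed in forward or backward time as needed), with $\varphi^\pm(0)=0$. The origin is a $(2k^+,2k^-)$-tangential center if moreover the first-return map is the identity near the origin; then $\varphi^+=\varphi^-$, and this common map is denoted $\varphi$; it is known to be a smooth involution near $0$ with $\varphi(0)=0$. Near the origin $X^\pm\neq0$; put $\eta^+=\delta\,Y^+/X^+$ and $\eta^-=-\delta\,Y^-/X^-$, and let $t\mapsto y^\pm(t,x)$ be the solution of $\frac{dy}{dt}=\eta^\pm(x\pm\delta t,y)$, $y(0)=0$. The functions $T^\pm$ are $$T^\pm(x)=(\varphi(x)-x)\int_0^1\frac{1}{X^\pm\big(x+(\varphi(x)-x)t,\;y^\pm(\pm\delta(\varphi(x)-x)t,\,x)\big)}\,dt ,$$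 and $T(x)=\delta(T^-(x)-T^+(x))$, for $x\ge 0$ small, is the period of the closed trajectory of $Z$ through $(x,0)$ (with $T(0)=0$). *)

(* Defs.v *)
From Stdlib Require Export Reals.
From Coquelicot Require Export Coquelicot.

Open Scope R_scope.

Record vfield := VField { vx : R -> R -> R; vy : R -> R -> R }.

(* Coquelicot's [ex_diff_n f n x y] is the C^n condition stated at one point;
   required at every point of an open set it is C^n regularity on that set. *)
Definition smooth_on (V : R * R -> Prop) (f : R -> R -> R) : Prop :=
  forall (n : nat) (x y : R), V (x, y) -> ex_diff_n f n x y.

Definition smooth_vfield_on (V : R * R -> Prop) (Z : vfield) : Prop :=
  smooth_on V (vx Z) /\ smooth_on V (vy Z).

(* F g = <grad g, F> *)
Definition lie (F : vfield) (g : R -> R -> R) : R -> R -> R := fun x y =>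
  vx F x y * Derive (fun s => g s y) x + vy F x y * Derive (fun s => g x s) y.

(* The switching manifold is the zero set of h. *)
Definition h : R -> R -> R := fun _ y => y.

Definition lie_iter (F : vfield) (n : nat) : R -> R -> R := Nat.iter n (lie F) h.

(* Throughout, sg = 1 designates the upper field Z^+ (acting on y > 0) and
   sg = -1 the lower field Z^- (acting on y < 0). *)

(* Invisible contact of multiplicity m of F with {y = 0} at the origin. *)
Definition invisible_contact (sg : R) (F : vfield) (m : nat) : Prop :=
  (forall i : nat, (1 <= i <= m - 1)%nat -> lie_iter F i 0 0 = 0) /\
  sg * lie_iter F m 0 0 < 0.

Definition trajectory (V : R * R -> Prop) (F : vfield) (a b : R) (u v : R -> R)
  : Prop :=
  forall t : R, a <= t <= b ->
    V (u t, v t) /\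
    is_derive u t (vx F (u t) (v t)) /\
    is_derive v t (vy F (u t) (v t)).

(* An arc of trajectory of F, run in forward time from (x, 0) to (x', 0), which
   lies in {sg * y >= 0} and meets {y = 0} only at its two endpoints. *)
Definition forward_arc (V : R * R -> Prop) (sg : R) (F : vfield) (x x' : R)
  : Prop :=
  exists (tau : R) (u v : R -> R),
    0 < tau /\ trajectory V F 0 tau u v /\
    u 0 = x /\ v 0 = 0 /\ u tau = x' /\ v tau = 0 /\
    (forall t : R, 0 < t < tau -> 0 < sg * v t).

(* phi x is reached from x in forward or in backward time. *)
Definition half_return_map (V : R * R -> Prop) (sg : R) (F : vfield)
  (phi : R -> R) : Prop :=
  phi 0 = 0 /\
  locally' 0 (fun x =>
    forward_arc V sg F x (phi x) \/ forward_arc V sg F (phi x) x).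

Definition crossing (Zp Zm : vfield) (x : R) : Prop :=
  0 < vy Zp x 0 * vy Zm x 0.

(* The Filippov trajectory through (x, 0) makes one turn around the origin in
   forward time: an arc on one side of {y = 0} is followed, through a crossing
   point (x1, 0), by an arc on the other side which ends at (x', 0). *)
Definition first_return (V : R * R -> Prop) (Zp Zm : vfield) (x x' : R) : Prop :=
  exists x1 : R,
    crossing Zp Zm x /\ crossing Zp Zm x1 /\
    ((forward_arc V 1 Zp x x1 /\ forward_arc V (-1) Zm x1 x') \/
     (forward_arc V (-1) Zm x x1 /\ forward_arc V 1 Zp x1 x')).

Definition first_return_map (V : R * R -> Prop) (Zp Zm : vfield) (P : R -> R)
  : Prop :=
  P 0 = 0 /\ locally' 0 (fun x => first_return V Zp Zm x (P x)).

Definition monodromic_tangential_singularity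
  (V : R * R -> Prop) (Zp Zm : vfield) (kp km : nat) : Prop :=
  invisible_contact 1 Zp (2 * kp) /\
  invisible_contact (-1) Zm (2 * km) /\
  exists P : R -> R, first_return_map V Zp Zm P.

Definition tangential_center
  (V : R * R -> Prop) (Zp Zm : vfield) (kp km : nat) : Prop :=
  monodromic_tangential_singularity V Zp Zm kp km /\
  forall P : R -> R, first_return_map V Zp Zm P -> locally 0 (fun x => P x = x).

(* eta^+ = delta Y^+ / X^+ (sg = 1) and eta^- = - delta Y^- / X^- (sg = -1) *)
Definition eta (sg delta : R) (F : vfield) : R -> R -> R := fun x y =>
  sg * delta * vy F x y / vx F x y.

(* For x near 0, t |-> y t x solves dy/dt = eta (x + sg delta t, y), y(0) = 0,
   on the interval between 0 and sg delta (phi x - x), inside the domain where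
   eta is defined. *)
Definition eta_solution (V : R * R -> Prop) (sg delta : R) (F : vfield)
  (phi : R -> R) (y : R -> R -> R) : Prop :=
  locally 0 (fun x =>
    y 0 x = 0 /\
    forall s : R, 0 <= s <= 1 ->
      let t := sg * delta * (phi x - x) * s in
      V (x + sg * delta * t, y t x) /\
      vx F (x + sg * delta * t) (y t x) <> 0 /\
      is_derive (fun r => y r x) t (eta sg delta F (x + sg * delta * t) (y t x))).

Definition T_half (sg delta : R) (F : vfield) (phi : R -> R) (y : R -> R -> R)
  (x : R) : R :=
  (phi x - x) *
  RInt (fun t => / vx F (x + (phi x - x) * t)
                        (y (sg * delta * (phi x - x) * t) x)) 0 1.

Definition period (delta : R) (Zp Zm : vfield) (phi : R -> R)
  (yp ym : R -> R -> R) (x : R) : R :=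
  delta * (T_half (-1) delta Zm phi ym x - T_half 1 delta Zp phi yp x).

(* Main.v *)
Require Import Defs.
From Stdlib Require Import Arith Lra Lia Psatz.

(** Write p = 2k-1 and q = 2k for the multiplicity of a contact, and X0 for the
    value of X at the origin. The half-period T^±(x) is (phi x - x) times a mean
    of 1/X^± along the graph of a small solution, and this mean tends to 1/X0 as
    x tends to 0 ([mean_inverse_speed]). So T^± is differentiable at 0 with
    derivative (phi'(0) - 1) / X0, and everything rests on phi'(0) = -1
    ([half_return_slope]), which is read off the arcs of Z^+.

    The vanishing of the iterated Lie derivatives at the origin is first turned
    into the vanishing of the pure x-derivatives of Y
    ([contact_order_x_derivatives]): modulo the lower x-derivatives of Y, the
    (n+1)-st Lie derivative of h is X^n times the n-th x-derivative of Y. Hence,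
    near the origin, |Y - gamma x^p X| <= M (x^q + |y|), where gamma has the sign
    imposed by invisibility ([invisible_contact_bounds]).

    Consider then an arc of trajectory (u, v) from (a, 0) to (b, 0) in y >= 0,
    with X > 0. Along it dv/du = gamma u^p up to O(u^q + v). The integrating
    factors 1 - 2Lu and 1 + 2Lu absorb the error in v, and a term C u^q, of
    constant sign as q is even, absorbs the other one: the result is two barrier
    functions, one nonincreasing and one nondecreasing along the arc
    ([barrier_monotone]). They confine the arc to a box of size O(|a|), and at
    the endpoint v = 0 they give b^q = a^q (1 + O(|a|)), that is b = -a (1 + o(1))
    as soon as b and a have opposite signs, which monotonicity also gives
    ([core_arc_endpoints]). Reversing time and reflecting x reduce to this case
    the arcs that end at (a, 0) and the fields with X < 0.

    Finally X^+ and X^- have opposite signs at the origin because Y^+ Y^- > 0 at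
    the crossing points near 0, while Y^± has the sign of gamma^± X^± at (x, 0)
    for small x > 0 ([opposite_speeds]). *)

(** * Calculus of smooth functions on an open set *)

Definition dx (f : R -> R -> R) : R -> R -> R :=
  fun x y => Derive (fun s => f s y) x.
Definition dy (f : R -> R -> R) : R -> R -> R :=
  fun x y => Derive (fun s => f x s) y.
Definition dxn (n : nat) (f : R -> R -> R) : R -> R -> R := Nat.iter n dx f.

(** Sums and products have to be treated one order of regularity at a time, since
    the partial derivatives of a product of C^(n+1) functions are only known to be
    built from C^n functions. *)
Definition Cn_on (V : R * R -> Prop) (n : nat) (f : R -> R -> R) : Prop :=
  forall x y, V (x, y) -> ex_diff_n f n x y.

Section SmoothCalculus.

Context (V : R * R -> Prop) (V_open : open V).

Lemma open_locally_2d (P : R -> R -> Prop) x y :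
  V (x, y) -> (forall u v, V (u, v) -> P u v) -> locally_2d P x y.
Proof.
  intros HV HP; apply locally_2d_locally.
  apply filter_imp with (P := V); [|exact (V_open _ HV)].
  intros [u v] Huv; exact (HP u v Huv).
Qed.

Lemma open_locally_slice_x (P : R -> Prop) x y :
  V (x, y) -> (forall s, V (s, y) -> P s) -> locally x P.
Proof.
  intros HV HP.
  destruct (open_locally_2d (fun u v => V (u, v)) x y HV (fun _ _ H => H))
    as [d Hd].
  exists d; intros s Hs; apply HP, Hd; [exact Hs|].
  rewrite Rminus_diag, Rabs_R0; apply cond_pos.
Qed.

Lemma open_locally_slice_y (P : R -> Prop) x y :
  V (x, y) -> (forall s, V (x, s) -> P s) -> locally y P.
Proof.
  intros HV HP.
  destruct (open_locally_2d (fun u v => V (u, v)) x y HV (fun _ _ H => H))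
    as [d Hd].
  exists d; intros s Hs; apply HP, Hd; [|exact Hs].
  rewrite Rminus_diag, Rabs_R0; apply cond_pos.
Qed.

Lemma dx_ext f g x y : V (x, y) ->
  (forall u v, V (u, v) -> f u v = g u v) -> dx f x y = dx g x y.
Proof.
  intros HV E; apply Derive_ext_loc, (open_locally_slice_x _ x y HV); auto.
Qed.

Lemma dy_ext f g x y : V (x, y) ->
  (forall u v, V (u, v) -> f u v = g u v) -> dy f x y = dy g x y.
Proof.
  intros HV E; apply Derive_ext_loc, (open_locally_slice_y _ x y HV); auto.
Qed.

Lemma Cn_on_ext n f g :
  (forall x y, V (x, y) -> f x y = g x y) -> Cn_on V n f -> Cn_on V n g.
Proof.
  intros E H x y HV; apply ex_diff_n_ext_loc with f; [|now apply H].
  now apply open_locally_2d.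
Qed.

Lemma Cn_on_pred n f : Cn_on V (S n) f -> Cn_on V n f.
Proof.
  intros H x y HV; apply ex_diff_n_m with (S n); [lia|now apply H].
Qed.

Lemma Cn_on_plus n f g :
  Cn_on V n f -> Cn_on V n g -> Cn_on V n (fun x y => f x y + g x y).
Proof.
  revert f g; induction n as [|n IH]; intros f g Hf Hg x y HV.
  - split; [|exact I].
    apply continuity_2d_pt_plus; [apply (Hf x y HV)|apply (Hg x y HV)].
  - destruct (Hf x y HV) as (cf & fx & fy & _).
    destruct (Hg x y HV) as (cg & gx & gy & _).
    repeat split.
    + now apply continuity_2d_pt_plus.
    + apply (ex_derive_plus (fun z => f z y) (fun z => g z y)); auto.
    + apply (ex_derive_plus (fun z => f x z) (fun z => g x z)); auto.
    + apply (Cn_on_ext n (fun u v => dx f u v + dx g u v)); auto.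
      * intros u v Huv; symmetry.
        apply (Derive_plus (fun z => f z v) (fun z => g z v));
          [apply (Hf u v Huv)|apply (Hg u v Huv)].
      * apply IH; intros u v Huv; [apply (Hf u v Huv)|apply (Hg u v Huv)].
    + apply (Cn_on_ext n (fun u v => dy f u v + dy g u v)); auto.
      * intros u v Huv; symmetry.
        apply (Derive_plus (fun z => f u z) (fun z => g u z));
          [apply (Hf u v Huv)|apply (Hg u v Huv)].
      * apply IH; intros u v Huv; [apply (Hf u v Huv)|apply (Hg u v Huv)].
Qed.

Lemma Cn_on_mult n f g :
  Cn_on V n f -> Cn_on V n g -> Cn_on V n (fun x y => f x y * g x y).
Proof.
  revert f g; induction n as [|n IH]; intros f g Hf Hg x y HV.
  - split; [|exact I].
    apply continuity_2d_pt_mult; [apply (Hf x y HV)|apply (Hg x y HV)].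
  - destruct (Hf x y HV) as (cf & fx & fy & _).
    destruct (Hg x y HV) as (cg & gx & gy & _).
    assert (Hf' := Cn_on_pred n f Hf); assert (Hg' := Cn_on_pred n g Hg).
    repeat split.
    + now apply continuity_2d_pt_mult.
    + apply (ex_derive_mult (fun z => f z y) (fun z => g z y)); auto.
    + apply (ex_derive_mult (fun z => f x z) (fun z => g x z)); auto.
    + apply (Cn_on_ext n (fun u v => dx f u v * g u v + f u v * dx g u v)); auto.
      * intros u v Huv; symmetry.
        apply (Derive_mult (fun z => f z v) (fun z => g z v));
          [apply (Hf u v Huv)|apply (Hg u v Huv)].
      * apply Cn_on_plus; apply IH; auto;
          intros u v Huv; [apply (Hf u v Huv)|apply (Hg u v Huv)].
    + apply (Cn_on_ext n (fun u v => dy f u v * g u v + f u v * dy g u v)); auto.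
      * intros u v Huv; symmetry.
        apply (Derive_mult (fun z => f u z) (fun z => g u z));
          [apply (Hf u v Huv)|apply (Hg u v Huv)].
      * apply Cn_on_plus; apply IH; auto;
          intros u v Huv; [apply (Hf u v Huv)|apply (Hg u v Huv)].
Qed.

Lemma smooth_on_ext f g :
  (forall x y, V (x, y) -> f x y = g x y) -> smooth_on V f -> smooth_on V g.
Proof. intros E H n; exact (Cn_on_ext n f g E (H n)). Qed.

Lemma smooth_on_plus f g :
  smooth_on V f -> smooth_on V g -> smooth_on V (fun x y => f x y + g x y).
Proof. intros Hf Hg n; exact (Cn_on_plus n f g (Hf n) (Hg n)). Qed.

Lemma smooth_on_mult f g :
  smooth_on V f -> smooth_on V g -> smooth_on V (fun x y => f x y * g x y).
Proof. intros Hf Hg n; exact (Cn_on_mult n f g (Hf n) (Hg n)). Qed.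

Lemma smooth_on_dx f : smooth_on V f -> smooth_on V (dx f).
Proof. intros H n x y HV; apply (H (S n) x y HV). Qed.

Lemma smooth_on_dy f : smooth_on V f -> smooth_on V (dy f).
Proof. intros H n x y HV; apply (H (S n) x y HV). Qed.

Lemma smooth_on_dxn n f : smooth_on V f -> smooth_on V (dxn n f).
Proof. intros H; induction n; [exact H|]; apply smooth_on_dx, IHn. Qed.

Lemma smooth_on_const c : smooth_on V (fun _ _ => c).
Proof.
  intros n; revert c; induction n as [|n IH]; intros c x y HV.
  - split; [apply continuity_2d_pt_const|exact I].
  - repeat split.
    + apply continuity_2d_pt_const.
    + apply (ex_derive_const c).
    + apply (ex_derive_const c).
    + apply (Cn_on_ext n (fun _ _ => 0)); auto.
      * intros u v _; symmetry; apply Derive_const.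
      * intros u v Huv; exact (IH 0 u v Huv).
    + apply (Cn_on_ext n (fun _ _ => 0)); auto.
      * intros u v _; symmetry; apply Derive_const.
      * intros u v Huv; exact (IH 0 u v Huv).
Qed.

Lemma smooth_on_pow f n :
  smooth_on V f -> smooth_on V (fun x y => f x y ^ n).
Proof.
  intros Hf; induction n as [|n IH]; simpl.
  - apply smooth_on_const.
  - now apply smooth_on_mult.
Qed.

Lemma smooth_is_derive_x f x y : smooth_on V f -> V (x, y) ->
  is_derive (fun s => f s y) x (dx f x y).
Proof. intros Hf HV; apply Derive_correct, (Hf 1%nat x y HV). Qed.

Lemma smooth_is_derive_y f x y : smooth_on V f -> V (x, y) ->
  is_derive (fun s => f x s) y (dy f x y).
Proof. intros Hf HV; apply Derive_correct, (Hf 1%nat x y HV). Qed.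

Lemma smooth_continuity f x y : smooth_on V f -> V (x, y) ->
  continuity_2d_pt f x y.
Proof. intros Hf HV; apply (Hf 0%nat x y HV). Qed.

Lemma dx_plus f g x y : smooth_on V f -> smooth_on V g -> V (x, y) ->
  dx (fun u v => f u v + g u v) x y = dx f x y + dx g x y.
Proof.
  intros Hf Hg HV; apply (Derive_plus (fun z => f z y) (fun z => g z y));
    [apply (Hf 1%nat x y HV)|apply (Hg 1%nat x y HV)].
Qed.

Lemma dy_plus f g x y : smooth_on V f -> smooth_on V g -> V (x, y) ->
  dy (fun u v => f u v + g u v) x y = dy f x y + dy g x y.
Proof.
  intros Hf Hg HV; apply (Derive_plus (fun z => f x z) (fun z => g x z));
    [apply (Hf 1%nat x y HV)|apply (Hg 1%nat x y HV)].
Qed.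

Lemma dx_mult f g x y : smooth_on V f -> smooth_on V g -> V (x, y) ->
  dx (fun u v => f u v * g u v) x y = dx f x y * g x y + f x y * dx g x y.
Proof.
  intros Hf Hg HV; apply (Derive_mult (fun z => f z y) (fun z => g z y));
    [apply (Hf 1%nat x y HV)|apply (Hg 1%nat x y HV)].
Qed.

(** * Order of contact and derivatives in x *)

Section LieDerivatives.

Context (F : vfield) (F_smooth : smooth_vfield_on V F).
Let X := vx F.
Let Y := vy F.

(** The ideal generated by the first n derivatives of Y in x, among smooth functions
    on V. It absorbs all the lower-order terms of iterated Lie derivatives of h:
    differentiating in x raises n by one, and Y times anything is already in the
    ideal, as Y is its first generator. *)
Inductive x_jet_ideal (n : nat) : (R -> R -> R) -> Prop :=
| x_jet_zero : x_jet_ideal n (fun _ _ => 0)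
| x_jet_gen a i : smooth_on V a -> (i < n)%nat ->
    x_jet_ideal n (fun x y => a x y * dxn i Y x y)
| x_jet_plus f g : x_jet_ideal n f -> x_jet_ideal n g ->
    x_jet_ideal n (fun x y => f x y + g x y)
| x_jet_ext f g : (forall x y, V (x, y) -> f x y = g x y) ->
    x_jet_ideal n f -> x_jet_ideal n g.

Lemma x_jet_ideal_smooth n f : x_jet_ideal n f -> smooth_on V f.
Proof.
  induction 1 as [|a i Ha Hi|f g _ IHf _ IHg|f g E _ IHf].
  - apply smooth_on_const.
  - apply smooth_on_mult; [exact Ha|]. apply smooth_on_dxn, F_smooth.
  - now apply smooth_on_plus.
  - now apply smooth_on_ext with f.
Qed.


(** Differentiating a generator along F produces one new x-derivative of Y, with
    coefficient X a; the rest, including the whole of the Y dy part, stays in the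
    ideal. *)
Lemma lie_product n a i : smooth_on V a -> (i < n)%nat ->
  exists r, x_jet_ideal n r /\ forall x y, V (x, y) ->
    lie F (fun u v => a u v * dxn i Y u v) x y =
    X x y * a x y * dxn (S i) Y x y + r x y.
Proof.
  intros Ha Hi; destruct F_smooth as [SX SY].
  assert (SYi : smooth_on V (dxn i Y)) by now apply smooth_on_dxn.
  exists (fun x y => (X x y * dx a x y) * dxn i Y x y +
    dy (fun u v => a u v * dxn i Y u v) x y * dxn 0 Y x y).
  split.
  - apply (x_jet_plus n (fun x y => (X x y * dx a x y) * dxn i Y x y)
      (fun x y => dy (fun u v => a u v * dxn i Y u v) x y * dxn 0 Y x y)).
    + apply (x_jet_gen n (fun x y => X x y * dx a x y)); [|lia].
      now apply smooth_on_mult; [|apply smooth_on_dx].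
    + apply (x_jet_gen n (dy (fun u v => a u v * dxn i Y u v))); [|lia].
      now apply smooth_on_dy, smooth_on_mult.
  - intros x y HV.
    change (lie F ?g x y) with (X x y * dx g x y + Y x y * dy g x y).
    rewrite (dx_mult a (dxn i Y)) by assumption.
    change (dxn 0 Y) with Y; change (dxn (S i) Y) with (dx (dxn i Y)); ring.
Qed.

Lemma x_jet_ideal_lie n f : x_jet_ideal n f -> x_jet_ideal (S n) (lie F f).
Proof.
  induction 1 as [|a i Ha Hi|f g Hf IHf Hg IHg|f g E _ IHf].
  - apply x_jet_ext with (fun _ _ => 0); [|apply x_jet_zero].
    intros x y _; unfold lie; rewrite !Derive_const; ring.
  - destruct (lie_product (S n) a i Ha ltac:(lia)) as (r & Hr & E).
    apply x_jet_ext with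
      (fun x y => X x y * a x y * dxn (S i) Y x y + r x y).
    + intros x y HV; symmetry; auto.
    + apply (x_jet_plus _ (fun x y => X x y * a x y * dxn (S i) Y x y)); auto.
      apply (x_jet_gen _ (fun x y => X x y * a x y)); [|lia].
      apply smooth_on_mult; [apply F_smooth|exact Ha].
  - apply x_jet_ideal_smooth in Hf; apply x_jet_ideal_smooth in Hg.
    apply x_jet_ext with (fun x y => lie F f x y + lie F g x y);
      [|now apply x_jet_plus].
    intros x y HV; symmetry.
    change (vx F x y * dx (fun x y => f x y + g x y) x y +
            vy F x y * dy (fun x y => f x y + g x y) x y =
            (vx F x y * dx f x y + vy F x y * dy f x y) +
            (vx F x y * dx g x y + vy F x y * dy g x y)).
    rewrite dx_plus, dy_plus by assumption; ring.
  - apply x_jet_ext with (lie F f); [|exact IHf].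
    intros x y HV.
    change (vx F x y * dx f x y + vy F x y * dy f x y =
            vx F x y * dx g x y + vy F x y * dy g x y).
    now rewrite (dx_ext f g), (dy_ext f g).
Qed.

(** The function h itself is outside the ideal, but its Lie derivative is Y, from
    which the induction starts. *)
Lemma lie_iter_leading_term n :
  exists r, x_jet_ideal n r /\ forall x y, V (x, y) ->
    lie_iter F (S n) x y = X x y ^ n * dxn n Y x y + r x y.
Proof.
  destruct F_smooth as [SX SY].
  induction n as [|n (r & Hr & E)].
  - exists (fun _ _ => 0); split; [apply x_jet_zero|].
    intros x y _; simpl; unfold lie, h.
    rewrite Derive_const, Derive_id; unfold Y; ring.
  - destruct (lie_product (S n) (fun x y => X x y ^ n) n
      (smooth_on_pow X n SX) ltac:(lia)) as (r1 & Hr1 & E1).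
    exists (fun x y => r1 x y + lie F r x y); split.
    + apply x_jet_plus; [exact Hr1|now apply x_jet_ideal_lie].
    + intros x y HV.
      assert (Sl : smooth_on V (fun x y => X x y ^ n * dxn n Y x y)).
      { apply smooth_on_mult; [now apply smooth_on_pow|now apply smooth_on_dxn]. }
      assert (Sr := x_jet_ideal_smooth n r Hr).
      transitivity
        (lie F (fun x y => X x y ^ n * dxn n Y x y) x y + lie F r x y).
      2: { rewrite E1 by assumption. simpl; ring. }
      change (lie_iter F (S (S n)) x y) with
        (vx F x y * dx (lie_iter F (S n)) x y +
         vy F x y * dy (lie_iter F (S n)) x y).
      rewrite (dx_ext _ _ x y HV E), (dy_ext _ _ x y HV E).
      rewrite (dx_plus (fun x y => X x y ^ n * dxn n Y x y) r),
        (dy_plus (fun x y => X x y ^ n * dxn n Y x y) r) by assumption.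
      unfold lie, dx, dy; ring.
Qed.

Lemma x_jet_ideal_vanishes n f x y : x_jet_ideal n f -> V (x, y) ->
  (forall i, (i < n)%nat -> dxn i Y x y = 0) -> f x y = 0.
Proof.
  intros Hf HV Z.
  induction Hf as [|a i Ha Hi|f g _ IHf _ IHg|f g E _ IHf].
  - reflexivity.
  - rewrite Z by assumption; ring.
  - rewrite IHf, IHg; ring.
  - now rewrite <- E.
Qed.

Context (V_origin : V (0, 0)).

(** If X vanished at the origin together with Y, all Lie derivatives would vanish
    there. Once X(0,0) is nonzero, the leading term X^n dxn n Y controls each
    derivative in turn. *)
Lemma contact_order_x_derivatives (p : nat) : (0 < p)%nat ->
  (forall i, (1 <= i <= p)%nat -> lie_iter F i 0 0 = 0) ->
  lie_iter F (S p) 0 0 <> 0 ->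
  X 0 0 <> 0 /\ (forall i, (i < p)%nat -> dxn i Y 0 0 = 0) /\
  lie_iter F (S p) 0 0 = X 0 0 ^ p * dxn p Y 0 0.
Proof.
  intros Hp Hz Hnz.
  assert (EQ : forall n, (forall i, (i < n)%nat -> dxn i Y 0 0 = 0) ->
    lie_iter F (S n) 0 0 = X 0 0 ^ n * dxn n Y 0 0).
  { intros n Hn; destruct (lie_iter_leading_term n) as (r & Hr & E).
    rewrite E, (x_jet_ideal_vanishes n r 0 0 Hr) by assumption; ring. }
  assert (HX : X 0 0 <> 0).
  { intros HX0; apply Hnz.
    change (X 0 0 * dx (lie_iter F p) 0 0 + Y 0 0 * dy (lie_iter F p) 0 0 = 0).
    assert (Y00 : Y 0 0 = 0).
    { generalize (EQ 0%nat ltac:(intros i Hi; lia)).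
      rewrite (Hz 1%nat) by lia; unfold dxn; simpl; lra. }
    rewrite HX0, Y00; ring. }
  assert (Hd : forall i, (i < p)%nat -> dxn i Y 0 0 = 0).
  { intros i; induction i as [i IH] using lt_wf_ind; intros Hi.
    assert (E := EQ i (fun j Hj => IH j Hj ltac:(lia))).
    rewrite (Hz (S i)) in E by lia.
    destruct (Rmult_integral _ _ (eq_sym E)) as [E'|E']; [|exact E'].
    now destruct (pow_nonzero _ i HX). }
  repeat split; auto.
Qed.

End LieDerivatives.
End SmoothCalculus.
(** * Elementary one-variable estimates *)

(** Continuous induction: a bound that improves itself to a strict one on every
    initial interval where it holds cannot be reached. It confines solutions to
    the box in which the estimates on the field are valid. *)
Lemma bootstrap_bound (f : R -> R) (b r : R) : f 0 < r ->
  (forall t, 0 <= t <= b -> continuity_pt f t) ->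
  (forall t, 0 <= t <= b -> (forall s, 0 <= s <= t -> f s <= r) -> f t < r) ->
  forall t, 0 <= t <= b -> f t < r.
Proof.
  intros H0 Hc Hb t Ht.
  destruct (Rle_or_lt 0 b) as [b0|b0]; [|lra].
  set (E := fun t => 0 <= t <= b /\ forall s, 0 <= s <= t -> f s < r).
  assert (E0 : E 0).
  { split; [lra|]; intros s Hs; now replace s with 0 by lra. }
  destruct (completeness E) as (m & Hm1 & Hm2).
  { exists b; intros x [Hx _]; lra. }
  { now exists 0. }
  assert (m0 : 0 <= m) by now apply Hm1.
  assert (mb : m <= b) by (apply Hm2; intros x [Hx _]; lra).
  assert (below : forall s, 0 <= s < m -> f s < r).
  { intros s Hs; destruct (Rlt_or_le (f s) r) as [|C]; [assumption|exfalso].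
    assert (m <= s); [|lra]. apply Hm2; intros x [Hx Hxs].
    destruct (Rle_or_lt x s); [assumption|].
    generalize (Hxs s ltac:(lra)); lra. }
  (* If f m > r, continuity would give f > r just before m. *)
  assert (at_m : f m <= r).
  { destruct (Rle_or_lt (f m) r) as [|C]; [assumption|exfalso].
    destruct (Req_dec m 0) as [->|Hm0]; [lra|].
    destruct (Hc m ltac:(lra) (f m - r) ltac:(lra)) as (d & Hd & Hcd).
    set (s := Rmax 0 (m - d / 2)).
    assert (Hs : 0 <= s < m /\ m - d / 2 <= s).
    { unfold s; apply Rmax_case_strong; lra. }
    assert (Hfs : Rabs (f s - f m) < f m - r).
    { apply (Hcd s); split; [split; [exact I|lra]|].
      simpl; unfold R_dist, Rdist; rewrite Rabs_left; lra. }
    apply Rabs_def2 in Hfs; generalize (below s ltac:(lra)); lra. }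
  assert (at_m' : f m < r).
  { apply Hb; [lra|]; intros s Hs.
    destruct (Req_dec s m) as [->|]; [exact at_m|].
    apply Rlt_le, below; lra. }
  destruct (Rlt_or_le t m); [apply below; lra|].
  destruct (Req_dec m b) as [->|Hmb]; [now replace t with b by lra|exfalso].
  destruct (Hc m ltac:(lra) (r - f m) ltac:(lra)) as (d & Hd & Hcd).
  set (s := Rmin b (m + d / 2)).
  assert (Hs : m < s <= b /\ s <= m + d / 2).
  { unfold s; apply Rmin_case_strong; lra. }
  assert (s <= m); [|lra].
  apply Hm1; split; [lra|]; intros x Hx.
  destruct (Rlt_or_le x m); [apply below; lra|].
  destruct (Req_dec x m) as [->|]; [assumption|].
  assert (Hfx : Rabs (f x - f m) < r - f m).
  { apply (Hcd x); split; [split; [exact I|lra]|].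
    simpl; unfold R_dist, Rdist; rewrite Rabs_right; lra. }
  apply Rabs_def2 in Hfx; lra.
Qed.

Lemma mean_value_bound (f df : R -> R) (x B : R) :
  (forall s, Rabs s <= Rabs x -> is_derive f s (df s)) ->
  (forall s, Rabs s <= Rabs x -> Rabs (df s) <= B) ->
  Rabs (f x - f 0) <= B * Rabs x.
Proof.
  intros Hd HB.
  assert (Hs : forall s, Rmin 0 x <= s <= Rmax 0 x -> Rabs s <= Rabs x).
  { intros s; unfold Rmin, Rmax; destruct (Rle_dec 0 x); intros;
      unfold Rabs; repeat destruct Rcase_abs; lra. }
  destruct (MVT_gen f 0 x df) as (c & Hc & E).
  - intros s Hs'; apply Hd, Hs; lra.
  - intros s Hs'; apply derivable_continuous_pt; exists (df s).
    now apply is_derive_Reals, Hd, Hs.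
  - rewrite E, Rminus_0_r, Rabs_mult.
    apply Rmult_le_compat_r; [apply Rabs_pos|]; apply HB, Hs, Hc.
Qed.

(** Taylor's formula at 0 with a remainder of one order more, by integrating the
    estimate on the p-th derivative p times. *)
Lemma vanishing_jet_estimate (p : nat) (f : nat -> R -> R) (r K M : R) :
  0 <= M ->
  (forall i x, (i < p)%nat -> Rabs x <= r -> is_derive (f i) x (f (S i) x)) ->
  (forall i, (i < p)%nat -> f i 0 = 0) ->
  (forall x, Rabs x <= r -> Rabs (f p x - K) <= M * Rabs x) ->
  forall x, Rabs x <= r ->
  Rabs (f 0%nat x - K / INR (fact p) * x ^ p) <= M * Rabs x ^ S p.
Proof.
  intros HM; revert f; induction p as [|p IH]; intros f Hd Hz HK x Hx.
  - simpl. replace (K / 1 * 1) with K by field. rewrite Rmult_1_r; now apply HK.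
  - assert (IH' := IH (fun i => f (S i))
      (fun i y Hi => Hd (S i) y (proj1 (Nat.succ_lt_mono i p) Hi))
      (fun i Hi => Hz (S i) (proj1 (Nat.succ_lt_mono i p) Hi)) HK).
    assert (Fp := INR_fact_neq_0 p).
    assert (Sp : INR (S p) <> 0) by now apply not_0_INR.
    generalize (mean_value_bound
      (fun x => f 0%nat x - K / INR (fact (S p)) * x ^ S p)
      (fun x => f 1%nat x - K / INR (fact p) * x ^ p) x (M * Rabs x ^ S p)).
    rewrite (Hz 0%nat) by lia.
    replace (0 - K / INR (fact (S p)) * 0 ^ S p) with 0 by (simpl; ring).
    rewrite Rminus_0_r; intros MV.
    replace (M * Rabs x ^ S (S p)) with (M * Rabs x ^ S p * Rabs x)
      by (simpl; ring).
    apply MV.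
    + intros s Hs.
      apply (is_derive_minus (f 0%nat) (fun x => K / INR (fact (S p)) * x ^ S p)).
      * apply Hd; [lia|lra].
      * replace (K / INR (fact p) * s ^ p)
          with (K / INR (fact (S p)) * (INR (S p) * 1 * s ^ p)).
        { apply is_derive_scal.
          exact (is_derive_pow (fun x => x) (S p) s 1 (is_derive_id s)). }
        rewrite fact_simpl, mult_INR; field; auto.
    + intros s Hs. apply Rle_trans with (M * Rabs s ^ S p).
      * apply IH'; lra.
      * apply Rmult_le_compat_l; [exact HM|].
        apply pow_incr; split; [apply Rabs_pos|exact Hs].
Qed.

Lemma nonincreasing_of_derive (f df : R -> R) (a b : R) : a <= b ->
  (forall t, a <= t <= b -> is_derive f t (df t)) ->
  (forall t, a <= t <= b -> df t <= 0) -> f b <= f a.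
Proof.
  intros Hab Hd Hn.
  destruct (MVT_gen f a b df) as (c & Hc & E);
    rewrite ?Rmin_left, ?Rmax_right in * by lra.
  - intros; apply Hd; lra.
  - intros s Hs; apply derivable_continuous_pt; exists (df s).
    now apply is_derive_Reals, Hd.
  - generalize (Hn c Hc); nra.
Qed.

Lemma is_derive_at_0 (f : R -> R) (l : R) : f 0 = 0 ->
  (forall eps, 0 < eps ->
     locally 0 (fun x => Rabs (f x - l * x) <= eps * Rabs x)) ->
  is_derive f 0 l.
Proof.
  intros H0 H; apply is_derive_Reals; intros eps Heps.
  destruct (H (eps / 2) ltac:(lra)) as [d Hd].
  exists d; intros s Hs Hsd.
  assert (Hs' : Rabs (f s - l * s) <= eps / 2 * Rabs s).
  { apply Hd; change (Rabs (s - 0) < d); now rewrite Rminus_0_r. }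
  rewrite Rplus_0_l, H0, Rminus_0_r.
  replace (f s / s - l) with ((f s - l * s) / s) by (field; exact Hs).
  assert (0 < Rabs s) by now apply Rabs_pos_lt.
  unfold Rdiv; rewrite Rabs_mult, Rabs_inv.
  apply Rmult_lt_reg_r with (Rabs s); [assumption|].
  rewrite Rmult_assoc, Rinv_l, Rmult_1_r by lra.
  nra.
Qed.

(** * Bounds near an invisible tangency *)

(** For gamma < 0, the form of an invisible tangency of a field going right: the
    slope Y / X of trajectories is gamma x^(2k-1) up to O(x^(2k) + |y|). *)
Definition near_tangency (X Y : R -> R -> R) (k : nat) (gamma r m M : R) : Prop :=
  0 < r /\ 0 < m /\ 0 <= M /\
  forall x y, Rabs x <= r -> Rabs y <= r ->
    m <= X x y /\
    Rabs (Y x y - gamma * x ^ (2 * k - 1) * X x y) <= M * (x ^ (2 * k) + Rabs y).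

Lemma pow_even_nonneg x k : 0 <= x ^ (2 * k).
Proof. rewrite pow_mult; apply pow_le, pow2_ge_0. Qed.

Lemma pow_even_abs x k : Rabs x ^ (2 * k) = x ^ (2 * k).
Proof. now rewrite !pow_mult, pow2_abs. Qed.

Section LocalBounds.

Context (V : R * R -> Prop) (V_open : open V) (V_origin : V (0, 0)).

Lemma smooth_on_near_origin f (eps : R) : smooth_on V f -> 0 < eps ->
  exists r, 0 < r /\ forall x y, Rabs x <= r -> Rabs y <= r ->
    V (x, y) /\ Rabs (f x y - f 0 0) <= eps.
Proof.
  intros Hf Heps.
  destruct (smooth_continuity V f 0 0 Hf V_origin (mkposreal eps Heps))
    as [d1 H1].
  destruct (open_locally_2d V V_open (fun u v => V (u, v)) 0 0 V_origin
    (fun _ _ H => H)) as [d2 H2].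
  exists (Rmin d1 d2 / 2).
  assert (Hd : 0 < Rmin d1 d2) by (apply Rmin_pos; apply cond_pos).
  generalize (Rmin_l d1 d2) (Rmin_r d1 d2); intros L1 L2.
  split; [lra|]; intros x y Hx Hy; split.
  - apply H2; rewrite Rminus_0_r; lra.
  - apply Rlt_le, (H1 x y); rewrite Rminus_0_r; lra.
Qed.

Lemma smooth_lipschitz_near_origin f : smooth_on V f ->
  exists r B, 0 < r /\ 0 <= B /\ forall x y, Rabs x <= r -> Rabs y <= r ->
    Rabs (f x y - f x 0) <= B * Rabs y /\ Rabs (f x 0 - f 0 0) <= B * Rabs x.
Proof.
  intros Hf.
  destruct (smooth_on_near_origin (dx f) 1 (smooth_on_dx V f Hf) Rlt_0_1)
    as (r1 & Hr1 & H1).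
  destruct (smooth_on_near_origin (dy f) 1 (smooth_on_dy V f Hf) Rlt_0_1)
    as (r2 & Hr2 & H2).
  set (B := Rabs (dx f 0 0) + Rabs (dy f 0 0) + 1).
  exists (Rmin r1 r2), B.
  assert (Hr : 0 < Rmin r1 r2) by now apply Rmin_pos.
  generalize (Rmin_l r1 r2) (Rmin_r r1 r2); intros L1 L2.
  assert (P1 := Rabs_pos (dx f 0 0)); assert (P2 := Rabs_pos (dy f 0 0)).
  assert (bound : forall a b, Rabs (a - b) <= 1 -> Rabs a <= Rabs b + 1).
  { intros a b Hab; replace a with ((a - b) + b) by ring.
    apply Rle_trans with (1 := Rabs_triang _ _); lra. }
  split; [exact Hr|]; split; [unfold B; lra|].
  intros x y Hx Hy; split.
  - apply (mean_value_bound (fun s => f x s) (dy f x)).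
    + intros s Hs; apply (smooth_is_derive_y V); [exact Hf|].
      apply (H2 x s); lra.
    + intros s Hs; destruct (H2 x s) as [_ Hb]; try lra.
      apply bound in Hb; unfold B; lra.
  - apply (mean_value_bound (fun s => f s 0) (fun s => dx f s 0)).
    + intros s Hs; apply (smooth_is_derive_x V); [exact Hf|].
      apply (H1 s 0); rewrite ?Rabs_R0; lra.
    + intros s Hs; destruct (H1 s 0) as [_ Hb]; rewrite ?Rabs_R0; try lra.
      apply bound in Hb; unfold B; lra.
Qed.

(** With p = 2k-1, the Lie derivative of order p + 1 is X^p times the p-th
    x-derivative D of Y, so that gamma = D / (p! X) has its sign, p + 1 being even.
    This sign is the same for X > 0 and X < 0. *)
Lemma invisible_contact_bounds (F : vfield) (sg : R) (k : nat) :
  smooth_vfield_on V F -> (0 < k)%nat ->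
  invisible_contact sg F (2 * k) ->
  vx F 0 0 <> 0 /\
  exists gamma r M, sg * gamma < 0 /\ 0 < r /\ 0 <= M /\
  forall x y, Rabs x <= r -> Rabs y <= r ->
    Rabs (vx F x y - vx F 0 0) <= Rabs (vx F 0 0) / 2 /\
    Rabs (vy F x y - gamma * x ^ (2 * k - 1) * vx F x y)
      <= M * (x ^ (2 * k) + Rabs y).
Proof.
  intros [SX SY] Hk [Hz Hneg].
  set (p := (2 * k - 1)%nat).
  assert (Ep : (2 * k)%nat = S p) by (unfold p; lia).
  rewrite Ep in *.
  replace (S p - 1)%nat with p in Hz by lia.
  destruct (contact_order_x_derivatives V V_open F (conj SX SY) V_origin p)
    as (HX & Hd & EL); [unfold p; lia|exact Hz|intros E; rewrite E in Hneg; lra|].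
  split; [exact HX|].
  set (X0 := vx F 0 0) in *.
  set (D := dxn p (vy F) 0 0) in *.
  set (gamma := D / INR (fact p) / X0).
  assert (PX := Rabs_pos_lt _ HX).
  destruct (smooth_on_near_origin (vx F) (Rabs X0 / 2) SX ltac:(lra))
    as (r1 & Hr1 & H1).
  destruct (smooth_lipschitz_near_origin (vx F) SX) as (r2 & B2 & Hr2 & HB2 & H2).
  destruct (smooth_lipschitz_near_origin (vy F) SY) as (r3 & B3 & Hr3 & HB3 & H3).
  destruct (smooth_lipschitz_near_origin (dxn p (vy F))
    (smooth_on_dxn V p _ SY)) as (r4 & B4 & Hr4 & HB4 & H4).
  set (r := Rmin 1 (Rmin r1 (Rmin r2 (Rmin r3 r4)))).
  assert (Hr : 0 < r) by (repeat apply Rmin_pos; lra).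
  assert (Lr : r <= 1 /\ r <= r1 /\ r <= r2 /\ r <= r3 /\ r <= r4).
  { unfold r.
    generalize (Rmin_l 1 (Rmin r1 (Rmin r2 (Rmin r3 r4))))
      (Rmin_r 1 (Rmin r1 (Rmin r2 (Rmin r3 r4))))
      (Rmin_l r1 (Rmin r2 (Rmin r3 r4))) (Rmin_r r1 (Rmin r2 (Rmin r3 r4)))
      (Rmin_l r2 (Rmin r3 r4)) (Rmin_r r2 (Rmin r3 r4))
      (Rmin_l r3 r4) (Rmin_r r3 r4); lra. }
  destruct Lr as (Lr & Lr1 & Lr2 & Lr3 & Lr4).
  assert (Pg := Rabs_pos gamma).
  exists gamma, r, (B3 + B4 + Rabs gamma * B2).
  split; [|split; [exact Hr|split; [nra|]]].
  - (* gamma = lie_iter (2k) / ((2k-1)! X^(2k)) at the origin *)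
    assert (Eg : gamma = lie_iter F (S p) 0 0 / (INR (fact p) * X0 ^ S p)).
    { rewrite EL; unfold gamma; simpl; field.
      repeat split; auto using pow_nonzero, INR_fact_neq_0. }
    assert (0 < INR (fact p) * X0 ^ S p).
    { apply Rmult_lt_0_compat; [apply INR_fact_lt_0|].
      rewrite <- Ep, pow_mult; apply pow_lt.
      rewrite <- Rsqr_pow2; now apply Rlt_0_sqr. }
    rewrite Eg; unfold Rdiv; rewrite <- Rmult_assoc.
    assert (0 < / (INR (fact p) * X0 ^ S p)) by now apply Rinv_0_lt_compat.
    nra.
  - intros x y Hx Hy; split; [apply H1; lra|].
    assert (Pxp : 0 <= Rabs x ^ p <= 1).
    { split; [apply pow_le, Rabs_pos|].
      rewrite <- (pow1 p); apply pow_incr; split; [apply Rabs_pos|lra]. }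
    destruct (H2 x y) as [Xy Xx]; try lra.
    destruct (H3 x y) as [Yy _]; try lra.
    assert (Yx : Rabs (vy F x 0 - D / INR (fact p) * x ^ p) <= B4 * Rabs x ^ S p).
    { apply (vanishing_jet_estimate p (fun i s => dxn i (vy F) s 0) r D B4); auto.
      - intros i s Hi Hs; apply (smooth_is_derive_x V).
        + now apply smooth_on_dxn.
        + apply (H1 s 0); rewrite ?Rabs_R0; lra.
      - intros s Hs; apply (H4 s 0); rewrite ?Rabs_R0; lra. }
    replace (vy F x y - gamma * x ^ p * vx F x y) with
      ((vy F x y - vy F x 0) + ((vy F x 0 - D / INR (fact p) * x ^ p) +
       (- (gamma * x ^ p * (vx F x y - vx F x 0)) +
        - (gamma * x ^ p * (vx F x 0 - X0))))).
    2: { unfold gamma; field; auto using INR_fact_neq_0. }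
    assert (T1 : Rabs (gamma * x ^ p * (vx F x y - vx F x 0))
                 <= Rabs gamma * B2 * Rabs y).
    { rewrite !Rabs_mult, <- RPow_abs.
      assert (Py := Rabs_pos (vx F x y - vx F x 0)).
      replace (Rabs gamma * B2 * Rabs y) with (Rabs gamma * (1 * (B2 * Rabs y)))
        by ring.
      rewrite Rmult_assoc; apply Rmult_le_compat_l; [exact Pg|].
      apply Rmult_le_compat; lra. }
    assert (T2 : Rabs (gamma * x ^ p * (vx F x 0 - X0))
                 <= Rabs gamma * B2 * x ^ S p).
    { rewrite !Rabs_mult, <- RPow_abs.
      rewrite <- Ep, <- pow_even_abs, Ep; simpl.
      replace (Rabs gamma * B2 * (Rabs x * Rabs x ^ p))
        with (Rabs gamma * Rabs x ^ p * (B2 * Rabs x)) by ring.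
      apply Rmult_le_compat_l; [|exact Xx].
      apply Rmult_le_pos; lra. }
    assert (Ex : Rabs x ^ S p = x ^ S p) by now rewrite <- Ep, pow_even_abs.
    rewrite Ex in Yx.
    assert (Px : 0 <= x ^ S p) by (rewrite <- Ep; apply pow_even_nonneg).
    assert (Py := Rabs_pos y).
    eapply Rle_trans; [apply Rabs_triang|].
    eapply Rle_trans; [apply Rplus_le_compat_l, Rabs_triang|].
    eapply Rle_trans; [apply Rplus_le_compat_l, Rplus_le_compat_l, Rabs_triang|].
    rewrite !Rabs_Ropp.
    assert (0 <= B3 * x ^ S p) by now apply Rmult_le_pos.
    assert (0 <= B4 * Rabs y) by now apply Rmult_le_pos.
    lra.
Qed.

End LocalBounds.
(** * Arcs over an invisible tangency *)

(** Arcs in the upper half-plane for an arbitrary pair of components and with no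
    domain, so that reversed and reflected fields are covered as well. *)
Definition arc (X Y : R -> R -> R) (a b : R) : Prop :=
  exists (tau : R) (u v : R -> R),
    0 < tau /\
    (forall t, 0 <= t <= tau ->
       is_derive u t (X (u t) (v t)) /\ is_derive v t (Y (u t) (v t))) /\
    u 0 = a /\ v 0 = 0 /\ u tau = b /\ v tau = 0 /\
    (forall t, 0 < t < tau -> 0 < v t).

Lemma forward_arc_arc V F a b :
  forward_arc V 1 F a b -> arc (vx F) (vy F) a b.
Proof.
  intros (tau & u & v & Ht & Htr & u0 & v0 & u1 & v1 & Hv).
  exists tau, u, v.
  split; [exact Ht|]; split; [intros t Hin; apply Htr, Hin|].
  do 4 (split; [assumption|]).
  intros t Hin; generalize (Hv t Hin); lra.
Qed.

Lemma arc_mirror X Y a b : arc X Y a b ->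
  arc (fun x y => - X (- x) y) (fun x y => Y (- x) y) (- a) (- b).
Proof.
  intros (tau & u & v & Ht & Hd & u0 & v0 & u1 & v1 & Hv).
  exists tau, (fun t => - u t), v.
  split; [exact Ht|]; split.
  - intros t Hin; rewrite Ropp_involutive; destruct (Hd t Hin) as [Du Dv].
    split; [exact (is_derive_opp u t _ Du)|exact Dv].
  - subst a b; auto.
Qed.

Lemma arc_reverse X Y a b : arc X Y a b ->
  arc (fun x y => - X x y) (fun x y => - Y x y) b a.
Proof.
  intros (tau & u & v & Ht & Hd & u0 & v0 & u1 & v1 & Hv).
  assert (rev : forall (f : R -> R) t l, is_derive f (tau - t) l ->
    is_derive (fun t => f (tau - t)) t (- l)).
  { intros f t l Hf.
    replace (- l) with (scal (-1) l) by (unfold scal; simpl; unfold mult; simpl; ring).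
    apply (is_derive_comp f (fun t => tau - t)); [exact Hf|].
    auto_derive; [exact I|ring]. }
  exists tau, (fun t => u (tau - t)), (fun t => v (tau - t)).
  rewrite Rminus_0_r, Rminus_diag.
  split; [exact Ht|]; split.
  - intros t Hin; split; apply rev, Hd; lra.
  - do 4 (split; [assumption|]); intros t Hin; apply Hv; lra.
Qed.

Lemma pow_scale_ge (e x : R) (n : nat) : 0 <= x -> 1 <= e ->
  e * x ^ S n <= (e * x) ^ S n.
Proof.
  intros Hx He; rewrite Rpow_mult_distr.
  apply Rmult_le_compat_r; [now apply pow_le|].
  simpl; generalize (pow_R1_Rle e n He); nra.
Qed.

Lemma pow_scale_le (e x : R) (n : nat) : 0 <= x -> 0 <= e <= 1 ->
  (e * x) ^ S n <= e * x ^ S n.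
Proof.
  intros Hx He; rewrite Rpow_mult_distr.
  apply Rmult_le_compat_r; [now apply pow_le|].
  assert (e ^ n <= 1) by (rewrite <- (pow1 n); apply pow_incr; lra).
  simpl; nra.
Qed.

(** Here be^q = al^q (1 + O(al)), and taking q-th roots only brings the ratio
    be / al closer to 1. *)
Lemma balanced_endpoints (q : nat) (c e al be : R) :
  (0 < q)%nat -> 0 <= c -> 0 < e -> 0 < al -> 0 < be -> be <= 4 * al ->
  c * al * (5 + 4 * e) < e ->
  be ^ q * (1 - c * be) <= al ^ q * (1 + c * al) ->
  al ^ q * (1 - c * al) <= be ^ q * (1 + c * be) ->
  Rabs (be - al) <= e * al.
Proof.
  intros Hq Hc He Hal Hbe H4 Hsmall Hup Hlo.
  destruct q as [|n]; [lia|].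
  assert (PA : 0 < al ^ S n) by now apply pow_lt.
  assert (PB : 0 < be ^ S n) by now apply pow_lt.
  assert (Hca : 0 <= c * al) by (apply Rmult_le_pos; lra).
  assert (Hcb : c * be <= 4 * (c * al)) by nra.
  set (A := al ^ S n) in *; set (B := be ^ S n) in *; set (d := c * al) in *.
  assert (d4 : 4 * d < 1).
  { apply Rnot_le_lt; intros C.
    assert (e <= d * (5 + 4 * e)) by nra. lra. }
  apply Rabs_le; split.
  - apply Rnot_lt_le; intros C.
    assert (e1 : e < 1).
    { apply Rnot_le_lt; intros C1; nra. }
    assert (HB : B <= (1 - e) * A).
    { apply Rle_trans with (((1 - e) * al) ^ S n).
      - apply pow_incr; lra.
      - apply pow_scale_le; lra. }
    assert (H1 : B * (1 + c * be) <= (1 - e) * A * (1 + 4 * d)).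
    { assert (0 <= c * be) by (apply Rmult_le_pos; lra).
      apply Rmult_le_compat; lra. }
    assert (H2 : A * (1 - d) <= A * ((1 - e) * (1 + 4 * d))) by lra.
    apply Rmult_le_reg_l in H2; [|exact PA]. nra.
  - apply Rnot_lt_le; intros C.
    assert (HB : (1 + e) * A <= B).
    { apply Rle_trans with (((1 + e) * al) ^ S n).
      - apply pow_scale_ge; lra.
      - apply pow_incr; split; [nra|lra]. }
    assert (H1 : (1 + e) * A * (1 - 4 * d) <= B * (1 - c * be)).
    { apply Rmult_le_compat; try lra. apply Rmult_le_pos; lra. }
    assert (H2 : A * ((1 + e) * (1 - 4 * d)) <= A * (1 + d)) by lra.
    apply Rmult_le_reg_l in H2; [|exact PA]. nra.
Qed.

Section CoreArc.

Context (X Y : R -> R -> R) (k : nat) (gamma r m M : R).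
Context (k_pos : (0 < k)%nat) (gamma_neg : gamma < 0).
Context (tangency : near_tangency X Y k gamma r m M).

Let p := (2 * k - 1)%nat.
(* Since X >= m, L X >= M: this is what makes the factor 1 - 2 L s x absorb the
   error M |y|. Then C absorbs M x^q together with the error that the factor itself
   makes on the main term gamma x^p X. *)
Let L := M / m.
Let C := 2 * L * (1 - gamma).
Let g := - gamma / INR (S p).
Let c := C / INR (S (S p)).

(** For s = 1 and s = -1, the opposite of the primitive vanishing at 0 of
    gamma x^p + s C x^(p+1): the height of the trajectory is nearly
    profile s a - profile s x. *)
Definition profile (s x : R) : R := g * x ^ S p - s * c * x ^ S (S p).
(** The height corrected by its integrating factor, minus the expected height up to
    a constant: an upper barrier for s = 1, a lower one for s = -1. *)
Definition barrier (s x y : R) : R := y * (1 - 2 * L * s * x) + profile s x.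

Lemma even_exponent : (2 * k)%nat = S p.
Proof. unfold p; lia. Qed.

Lemma core_constants : 0 < r /\ 0 < m /\ 0 <= M /\ 0 <= L /\ L * m = M /\
  0 <= C /\ 0 < g /\ 0 <= c /\ g * INR (S p) = - gamma /\ c * INR (S (S p)) = C.
Proof.
  destruct tangency as (Hr & Hm & HM & _).
  assert (Hp : 0 < INR (S p)) by (apply lt_0_INR; lia).
  assert (Hq : 0 < INR (S (S p))) by (apply lt_0_INR; lia).
  assert (HL : 0 <= L) by now apply Rdiv_le_0_compat.
  assert (HC : 0 <= C) by (unfold C; nra).
  repeat split; auto.
  - unfold L; field; lra.
  - apply Rdiv_lt_0_compat; lra.
  - now apply Rdiv_le_0_compat.
  - unfold g; field; lra.
  - unfold c; field; lra.
Qed.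

Lemma profile_opp s x : profile s (- x) = profile (- s) x.
Proof.
  assert (E : (- x) ^ S p = x ^ S p).
  { rewrite <- even_exponent, !pow_mult; f_equal; ring. }
  unfold profile.
  change ((- x) ^ S (S p)) with (- x * (- x) ^ S p).
  change (x ^ S (S p)) with (x * x ^ S p).
  rewrite E; ring.
Qed.

(** The derivative is x^p (- gamma - C x). *)
Lemma profile_increasing x y : 0 <= x -> x < y -> C * y < - gamma ->
  profile 1 x < profile 1 y.
Proof.
  intros Hx Hxy Hy.
  destruct core_constants as (_ & _ & _ & _ & _ & HC & _ & _ & Eg & Ec).
  destruct (MVT_cor2 (profile 1)
    (fun z => z ^ p * (- gamma - C * z)) x y Hxy) as (z & E & Hz).
  - intros z _; apply is_derive_Reals; unfold profile.
    auto_derive; [exact I|].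
    change (pred (S p)) with p; change (pred (S (S p))) with (S p).
    rewrite <- Eg, <- Ec.
    change (match p with 0%nat => 1 | S _ => INR p + 1 end) with (INR (S p)).
    rewrite (S_INR (S p)); simpl pow; ring.
  - assert (0 < z ^ p) by (apply pow_lt; lra).
    assert (0 < - gamma - C * z) by nra.
    assert (0 < z ^ p * (- gamma - C * z)) by now apply Rmult_lt_0_compat.
    nra.
Qed.

(** With D = Y - gamma u^p X, the derivative of s times the barrier is
    s (1 - 2 L s u) D - 2 L X (v + u^q), and in the box the factor of D is at most 2
    while |D| <= M (v + u^q) <= L X (v + u^q). *)
Lemma barrier_monotone (s r1 b : R) (u v : R -> R) :
  s * s = 1 -> r1 <= r -> 4 * L * r1 <= 1 -> 0 <= b ->
  (forall t, 0 <= t <= b ->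
     is_derive u t (X (u t) (v t)) /\ is_derive v t (Y (u t) (v t)) /\
     Rabs (u t) <= r1 /\ Rabs (v t) <= r1 /\ 0 <= v t) ->
  s * barrier s (u b) (v b) <= s * barrier s (u 0) (v 0).
Proof.
  intros Hs Hr1 HLr Hb H.
  destruct core_constants as (_ & Hm & HM & HL & ELm & HC & _ & _ & Eg & Ec).
  apply (nonincreasing_of_derive (fun t => s * barrier s (u t) (v t))
    (fun t => s * (Y (u t) (v t) * (1 - 2 * L * s * u t)
      - 2 * L * s * v t * X (u t) (v t)
      + (- gamma * u t ^ p - s * C * u t ^ S p) * X (u t) (v t)))); auto.
  - intros t Ht; destruct (H t Ht) as (Du & Dv & _).
    unfold barrier, profile; auto_derive.
    + assert (ex_derive u t) by now exists (X (u t) (v t)).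
      assert (ex_derive v t) by now exists (Y (u t) (v t)).
      tauto.
    + change (pred (S p)) with p; change (pred (S (S p))) with (S p).
      replace (Derive (fun x : R => u x) t) with (X (u t) (v t))
        by (symmetry; exact (is_derive_unique u t _ Du)).
      replace (Derive (fun x : R => v x) t) with (Y (u t) (v t))
        by (symmetry; exact (is_derive_unique v t _ Dv)).
      rewrite <- Eg, <- Ec.
      change (match p with 0%nat => 1 | S _ => INR p + 1 end) with (INR (S p)).
      rewrite (S_INR (S p)); simpl pow; ring.
  - intros t Ht; destruct (H t Ht) as (_ & _ & Hu & Hv & Hpos).
    destruct tangency as (_ & _ & _ & Hbox).
    destruct (Hbox (u t) (v t)) as [HX HD]; try lra.
    fold p in HD; rewrite even_exponent, (Rabs_pos_eq (v t)) in HD by exact Hpos.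
    set (D := Y (u t) (v t) - gamma * u t ^ p * X (u t) (v t)) in HD.
    assert (PQ : 0 <= u t ^ S p)
      by (rewrite <- even_exponent; apply pow_even_nonneg).
    replace (s * _) with
      (s * (1 - 2 * L * s * u t) * D
       - 2 * (L * X (u t) (v t)) * (v t + u t ^ S p)
       + (1 - s * s) * (2 * L * gamma * X (u t) (v t) * u t ^ S p
           + 2 * L * v t * X (u t) (v t) + C * u t ^ S p * X (u t) (v t))).
    2: { unfold C, D; simpl pow; ring. }
    rewrite Hs, Rminus_diag, Rmult_0_l, Rplus_0_r.
    assert (HLX : M <= L * X (u t) (v t))
      by (rewrite <- ELm; now apply Rmult_le_compat_l).
    assert (Hs1 : Rabs s = 1).
    { assert (Rabs s * Rabs s = 1) by (rewrite <- Rabs_mult, Hs; apply Rabs_R1).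
      assert (0 <= Rabs s) by apply Rabs_pos; nra. }
    assert (Hk : Rabs (s * (1 - 2 * L * s * u t)) <= 2).
    { rewrite Rabs_mult, Hs1, Rmult_1_l.
      apply Rle_trans with (1 := Rabs_triang _ _).
      rewrite Rabs_R1, Rabs_Ropp, !Rabs_mult, Hs1, Rmult_1_r.
      rewrite (Rabs_pos_eq 2), (Rabs_pos_eq L) by lra.
      assert (L * Rabs (u t) <= L * r1) by now apply Rmult_le_compat_l.
      lra. }
    assert (HkD : s * (1 - 2 * L * s * u t) * D <= 2 * (M * (u t ^ S p + v t))).
    { apply Rle_trans with (1 := Rle_abs _); rewrite Rabs_mult.
      apply Rmult_le_compat; auto using Rabs_pos. }
    assert (M * (v t + u t ^ S p) <= L * X (u t) (v t) * (v t + u t ^ S p))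
      by (apply Rmult_le_compat_r; lra).
    lra.
Qed.

(** The upper barrier confines the arc to |u| < 4|a|, v <= 3g|a|, hence to the box.
    At the endpoint both barriers compare the profiles of a and b. As u increases
    along the arc, b > a, and the monotonicity of the profiles excludes that a and
    b lie on the same side of 0. *)
Lemma core_arc_endpoints (eps : R) : 0 < eps ->
  exists rho, 0 < rho /\ forall a b, arc X Y a b -> a <> 0 -> Rabs a < rho ->
    Rabs (b + a) <= eps * Rabs a.
Proof.
  intros Heps.
  destruct core_constants as (Hr & Hm & HM & HL & ELm & HC & Hg & Hc & Eg & Ec).
  (* box size, small enough for the barriers to control u and v separately *)
  set (r1 := Rmin r (Rmin (/ (4 * L + 1)) (Rmin (- gamma / (2 * (C + 1)))
     (/ (2 * (c / g) + 1))))).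
  assert (Hcg : 0 <= c / g) by now apply Rdiv_le_0_compat.
  assert (P1 : 0 < / (4 * L + 1)) by (apply Rinv_0_lt_compat; lra).
  assert (P2 : 0 < - gamma / (2 * (C + 1))) by (apply Rdiv_lt_0_compat; lra).
  assert (P3 : 0 < / (2 * (c / g) + 1)) by (apply Rinv_0_lt_compat; lra).
  assert (Hr1 : 0 < r1) by (unfold r1; repeat apply Rmin_pos; assumption).
  assert (B0 : r1 <= r) by apply Rmin_l.
  assert (B1 : 4 * L * r1 <= 1).
  { assert (r1 <= / (4 * L + 1)).
    { unfold r1; eapply Rle_trans; [apply Rmin_r|]; apply Rmin_l. }
    assert ((4 * L + 1) * / (4 * L + 1) = 1) by (apply Rinv_r; lra). nra. }
  assert (B2 : C * r1 < - gamma).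
  { assert (r1 <= - gamma / (2 * (C + 1))).
    { unfold r1; do 2 (eapply Rle_trans; [apply Rmin_r|]); apply Rmin_l. }
    assert ((C + 1) * (- gamma / (2 * (C + 1))) = - gamma / 2) by (field; lra).
    nra. }
  assert (B3 : 2 * (c / g) * r1 <= 1).
  { assert (r1 <= / (2 * (c / g) + 1)).
    { unfold r1; do 2 (eapply Rle_trans; [apply Rmin_r|]); apply Rmin_r. }
    assert ((2 * (c / g) + 1) * / (2 * (c / g) + 1) = 1) by (apply Rinv_r; lra).
    nra. }
  set (rho := Rmin 1 (Rmin (r1 / (4 + 4 * g)) (eps / ((c / g + 1) * (5 + 4 * eps))))).
  assert (P4 : 0 < r1 / (4 + 4 * g)) by (apply Rdiv_lt_0_compat; lra).
  assert (P5 : 0 < eps / ((c / g + 1) * (5 + 4 * eps)))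
    by (apply Rdiv_lt_0_compat; nra).
  exists rho; split; [unfold rho; repeat apply Rmin_pos; lra|].
  intros a b (tau & u & v & Htau & Hd & u0 & v0 & u1 & v1 & Hv) Ha0 Ha.
  assert (Pa : 0 < Rabs a) by now apply Rabs_pos_lt.
  assert (A1 : Rabs a < 1) by (eapply Rlt_le_trans; [exact Ha|apply Rmin_l]).
  assert (A2 : (4 + 4 * g) * Rabs a < r1).
  { assert (Rabs a < r1 / (4 + 4 * g)).
    { eapply Rlt_le_trans; [exact Ha|].
      eapply Rle_trans; [apply Rmin_r|apply Rmin_l]. }
    assert ((4 + 4 * g) * (r1 / (4 + 4 * g)) = r1) by (field; lra). nra. }
  assert (A3 : c / g * Rabs a * (5 + 4 * eps) < eps).
  { assert (Rabs a < eps / ((c / g + 1) * (5 + 4 * eps))).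
    { eapply Rlt_le_trans; [exact Ha|].
      eapply Rle_trans; [apply Rmin_r|apply Rmin_r]. }
    assert ((c / g + 1) * (5 + 4 * eps) * (eps / ((c / g + 1) * (5 + 4 * eps)))
      = eps) by (field; split; lra).
    assert (0 < (c / g + 1) * (5 + 4 * eps)) by nra.
    assert (0 < Rabs a * (5 + 4 * eps)) by nra. nra. }
  clear P1 P2 P3 P4 P5.
  assert (v_nonneg : forall t, 0 <= t <= tau -> 0 <= v t).
  { intros t Ht; destruct (Req_dec t 0) as [->|]; [lra|].
    destruct (Req_dec t tau) as [->|]; [lra|].
    apply Rlt_le, Hv; lra. }
  assert (abs_q : forall x, Rabs x ^ S p = x ^ S p).
  { intros x; rewrite <- even_exponent; apply pow_even_abs. }
  assert (PA : 0 < a ^ S p <= Rabs a).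
  { rewrite <- abs_q; split; [now apply pow_lt|].
    assert (Rabs a ^ p <= 1) by (rewrite <- (pow1 p); apply pow_incr; lra).
    simpl; nra. }
  assert (barriers : forall t, 0 <= t <= tau ->
    (forall t', 0 <= t' <= t -> Rabs (u t') + Rabs (v t') <= r1) ->
    forall s, s * s = 1 -> s * barrier s (u t) (v t) <= s * profile s a).
  { intros t Ht Hbox s Hs.
    replace (profile s a) with (barrier s (u 0) (v 0))
      by (unfold barrier; rewrite u0, v0; ring).
    apply (barrier_monotone s r1 t u v); auto; [lra|].
    intros t' Ht'; destruct (Hd t') as [Du Dv]; [lra|].
    generalize (Hbox t' Ht') (Rabs_pos (u t')) (Rabs_pos (v t')); intros.
    split; [exact Du|]; split; [exact Dv|].
    split; [lra|]; split; [lra|]; apply v_nonneg; lra. }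
  (* The correction c u is at most g/2 in the box, whence g u^q <= 3 g a^q; then
     |u| < 4|a| because q >= 1. *)
  assert (shrink : forall t, 0 <= t <= tau ->
    (forall t', 0 <= t' <= t -> Rabs (u t') + Rabs (v t') <= r1) ->
    Rabs (u t) < 4 * Rabs a /\ Rabs (v t) <= 3 * g * Rabs a).
  { intros t Ht Hbox.
    generalize (barriers t Ht Hbox 1 ltac:(ring)); unfold barrier, profile.
    change (u t ^ S (S p)) with (u t * u t ^ S p).
    change (a ^ S (S p)) with (a * a ^ S p); intros HB.
    assert (Hu : Rabs (u t) <= r1)
      by (generalize (Hbox t ltac:(lra)) (Rabs_pos (v t)); lra).
    assert (Hvt := v_nonneg t Ht); rewrite (Rabs_pos_eq (v t)) by exact Hvt.
    assert (PQ : 0 <= u t ^ S p)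
      by (rewrite <- even_exponent; apply pow_even_nonneg).
    set (Q := u t ^ S p) in *; set (A := a ^ S p) in *.
    assert (cr : forall x, Rabs x <= r1 -> Rabs (c * x) <= g / 2).
    { intros x Hx; rewrite Rabs_mult, (Rabs_pos_eq c) by exact Hc.
      replace c with (g * (c / g)) by (field; lra).
      assert (c / g * Rabs x <= c / g * r1) by now apply Rmult_le_compat_l.
      nra. }
    generalize (proj1 (Rabs_le_between _ _) (cr (u t) Hu)); intros cu.
    assert (ca : Rabs (c * a) <= g / 2) by (apply cr; nra).
    apply Rabs_le_between in ca; apply Rabs_le_between in Hu.
    assert (Lu : L * u t <= L * r1) by now apply Rmult_le_compat_l.
    assert (N1 : v t / 2 <= v t * (1 - 2 * L * 1 * u t)) by nra.
    assert (N2 : g * Q / 2 <= g * Q - 1 * c * (u t * Q)) by nra.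
    assert (N3 : g * A - 1 * c * (a * A) <= 3 / 2 * (g * A)) by nra.
    assert (PgQ : 0 <= g * Q) by nra.
    assert (gA : g * A <= g * Rabs a) by (apply Rmult_le_compat_l; lra).
    split; [|nra].
    apply Rnot_le_lt; intros C4.
    assert (Q4 : 4 * A <= Q).
    { unfold A, Q; rewrite <- (abs_q a), <- (abs_q (u t)).
      apply Rle_trans with ((4 * Rabs a) ^ S p).
      - apply pow_scale_ge; lra.
      - apply pow_incr; lra. }
    nra. }
  assert (confined : forall t, 0 <= t <= tau -> Rabs (u t) + Rabs (v t) < r1).
  { apply (bootstrap_bound (fun t => Rabs (u t) + Rabs (v t))).
    - rewrite u0, v0, Rabs_R0; nra.
    - intros t Ht; destruct (Hd t Ht) as [Du Dv].
      apply (continuity_pt_plus (fun t => Rabs (u t)) (fun t => Rabs (v t)));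
        apply (continuity_pt_comp _ Rabs); try apply Rcontinuity_abs;
        apply derivable_continuous_pt.
      + exists (X (u t) (v t)); now apply is_derive_Reals.
      + exists (Y (u t) (v t)); now apply is_derive_Reals.
    - intros t Ht Hbox; destruct (shrink t Ht Hbox); nra. }
  assert (box : forall t, 0 <= t <= tau -> Rabs (u t) + Rabs (v t) <= r1)
    by (intros; now apply Rlt_le, confined).
  destruct (shrink tau ltac:(lra) (fun t Ht => box t Ht)) as [Hb _]; rewrite u1 in Hb.
  assert (Hab : a < b).
  { assert (m * tau - u tau <= m * 0 - u 0).
    { apply (nonincreasing_of_derive (fun t => m * t - u t)
        (fun t => m - X (u t) (v t))); [lra| |].
      - intros t Ht; apply (is_derive_minus (fun t => m * t) u).
        + auto_derive; [exact I|ring].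
        + apply Hd, Ht.
      - intros t Ht; destruct tangency as (_ & _ & _ & Hbox).
        generalize (box t Ht) (Rabs_pos (u t)) (Rabs_pos (v t)); intros.
        destruct (Hbox (u t) (v t)); lra. }
    rewrite u0, u1 in H; nra. }
  generalize (barriers tau ltac:(lra) box 1 ltac:(ring))
    (barriers tau ltac:(lra) box (-1) ltac:(ring)).
  unfold barrier; rewrite u1, v1; intros up lo.
  assert (up' : profile 1 b <= profile 1 a) by lra.
  assert (lo' : profile (-1) a <= profile (-1) b) by lra.
  clear up lo.
  assert (Hbr : Rabs b <= r1) by nra.
  assert (Cb : forall x, Rabs x <= r1 -> C * x < - gamma).
  { intros x Hx; apply Rabs_le_between in Hx; nra. }
  destruct (Rlt_or_le 0 a) as [a_pos|a_neg].
  - generalize (profile_increasing a b ltac:(lra) Hab (Cb b Hbr)); lra.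
  - destruct (Rlt_or_le 0 b) as [b_pos|b_neg].
    + assert (Ea : Rabs a = - a) by (apply Rabs_left1; lra).
      rewrite (Rabs_pos_eq b) in Hb by lra; rewrite Ea in *.
      rewrite <- (Ropp_involutive a), profile_opp in up', lo'.
      replace (b + a) with (b - - a) by ring.
      assert (fact1 : forall s x,
        profile s x = g * (x ^ S p * (1 - s * (c / g * x)))).
      { intros s x; unfold profile; simpl; field; lra. }
      rewrite !fact1 in up', lo'.
      apply Rmult_le_reg_l in up'; [|exact Hg].
      apply Rmult_le_reg_l in lo'; [|exact Hg].
      apply (balanced_endpoints (S p) (c / g)); try lra; lia.
    + rewrite <- (Ropp_involutive a), <- (Ropp_involutive b) in lo'.
      rewrite !(profile_opp (-1)) in lo'; replace (- -1) with 1 in lo' by ring.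
      generalize (profile_increasing (- b) (- a) ltac:(lra) ltac:(lra)
        (Cb (- a) ltac:(rewrite Rabs_Ropp; nra))).
      lra.
Qed.

End CoreArc.
Lemma locally_0_abs (d : R) : 0 < d -> locally 0 (fun x => Rabs x < d).
Proof.
  intros Hd; exists (mkposreal d Hd); intros x Hx.
  change (Rabs (x - 0) < d) in Hx; now rewrite Rminus_0_r in Hx.
Qed.

(** The reflection x -> -x preserves gamma, because 2k-1 is odd, and changes the sign
    of X: it brings a field with X < 0 to the normal form. *)
Lemma near_tangency_mirror X Y k gamma r m M :
  (0 < k)%nat -> 0 < r -> 0 < m -> 0 <= M ->
  (forall x y, Rabs x <= r -> Rabs y <= r ->
    m <= - X x y /\
    Rabs (Y x y - gamma * x ^ (2 * k - 1) * X x y) <= M * (x ^ (2 * k) + Rabs y)) ->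
  near_tangency (fun x y => - X (- x) y) (fun x y => Y (- x) y) k gamma r m M.
Proof.
  intros Hk Hr Hm HM H; do 3 (split; [assumption|]).
  intros x y Hx Hy.
  destruct (H (- x) y) as [HX HD]; [now rewrite Rabs_Ropp|exact Hy|].
  split; [exact HX|].
  rewrite <- (pow_even_abs (- x)), Rabs_Ropp, pow_even_abs in HD.
  assert (E : (- x) ^ (2 * k - 1) = - x ^ (2 * k - 1)).
  { replace (2 * k - 1)%nat with (S (2 * (k - 1))) by lia.
    simpl; fold (2 * (k - 1))%nat.
    rewrite <- (pow_even_abs (- x)), Rabs_Ropp, pow_even_abs; ring. }
  rewrite E in HD.
  now replace (Y (- x) y - gamma * x ^ (2 * k - 1) * - X (- x) y)
    with (Y (- x) y - gamma * - x ^ (2 * k - 1) * X (- x) y) by ring.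
Qed.

(** An arc ending at x becomes, after reversing time and reflecting x, an arc
    starting at -x for a field with the same bounds. *)
Lemma arc_endpoints_pos X Y k gamma r m M :
  (0 < k)%nat -> gamma < 0 -> near_tangency X Y k gamma r m M ->
  forall eps, 0 < eps -> exists rho, 0 < rho /\
  forall x x', arc X Y x x' \/ arc X Y x' x -> x <> 0 -> Rabs x < rho ->
    Rabs (x' + x) <= eps * Rabs x.
Proof.
  intros Hk Hg Hn eps Heps.
  assert (Hn' := Hn); destruct Hn' as (Hr & Hm & HM & H).
  destruct (core_arc_endpoints X Y k gamma r m M Hk Hg Hn eps Heps)
    as (rho1 & Hrho1 & H1).
  destruct (core_arc_endpoints (fun x y => - - X (- x) y) (fun x y => - Y (- x) y)
    k gamma r m M Hk Hg) with (eps := eps) as (rho2 & Hrho2 & H2); [|exact Heps|].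
  { apply (near_tangency_mirror (fun x y => - X x y) (fun x y => - Y x y)); auto.
    intros x y Hx Hy; destruct (H x y Hx Hy) as [HX HD].
    rewrite Ropp_involutive; split; [exact HX|].
    rewrite <- Rabs_Ropp.
    now replace (- (- Y x y - gamma * x ^ (2 * k - 1) * - X x y))
      with (Y x y - gamma * x ^ (2 * k - 1) * X x y) by ring. }
  exists (Rmin rho1 rho2); split; [now apply Rmin_pos|].
  intros x x' [A|A] Hx Hrho;
    generalize (Rmin_l rho1 rho2) (Rmin_r rho1 rho2); intros L1 L2.
  - apply H1; auto; lra.
  - apply arc_reverse, arc_mirror in A.
    apply H2 in A; [|lra|rewrite Rabs_Ropp; lra].
    rewrite Rabs_Ropp in A.
    now rewrite <- Rabs_Ropp, Ropp_plus_distr.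
Qed.

(** This says phi'(0) = -1, differentiability included: x and phi x are the two ends
    of an arc, and by [arc_endpoints_pos] these are nearly symmetric about 0. *)
Lemma half_return_slope (V : R * R -> Prop) (F : vfield) (k : nat) (phi : R -> R) :
  open V -> V (0, 0) -> smooth_vfield_on V F -> (0 < k)%nat ->
  invisible_contact 1 F (2 * k) -> half_return_map V 1 F phi ->
  forall eps, 0 < eps ->
  locally 0 (fun x => Rabs (phi x + x) <= eps * Rabs x).
Proof.
  intros V_open V_origin SF Hk HF [phi0 Hphi] eps Heps.
  destruct (invisible_contact_bounds V V_open V_origin F 1 k SF Hk HF)
    as (HX0 & gamma & r & M & Hg & Hr & HM & H).
  assert (Hg' : gamma < 0) by lra.
  set (X0 := vx F 0 0) in *.
  assert (PX : 0 < Rabs X0 / 2) by (generalize (Rabs_pos_lt _ HX0); lra).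
  assert (key : exists rho, 0 < rho /\ forall x x',
    arc (vx F) (vy F) x x' \/ arc (vx F) (vy F) x' x -> x <> 0 -> Rabs x < rho ->
    Rabs (x' + x) <= eps * Rabs x).
  { destruct (Rlt_or_le 0 X0) as [pos|neg].
    - apply (arc_endpoints_pos _ _ k gamma r (Rabs X0 / 2) M); auto.
      do 3 (split; [assumption|]).
      intros x y Hx Hy; destruct (H x y Hx Hy) as [B D]; split; [|exact D].
      apply Rabs_le_between in B; rewrite (Rabs_pos_eq X0) in * by lra; lra.
    - destruct (arc_endpoints_pos (fun x y => - vx F (- x) y)
        (fun x y => vy F (- x) y) k gamma r (Rabs X0 / 2) M) with (eps := eps)
        as (rho & Hrho & H1); auto.
      + apply near_tangency_mirror; auto.
        intros x y Hx Hy; destruct (H x y Hx Hy) as [B D]; split; [|exact D].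
        apply Rabs_le_between in B; rewrite (Rabs_left1 X0) in * by lra; lra.
      + exists rho; split; [exact Hrho|]; intros x x' A Hx Hxr.
        rewrite <- (Rabs_Ropp x), <- Rabs_Ropp, Ropp_plus_distr.
        apply H1; [|lra|now rewrite Rabs_Ropp].
        destruct A as [A|A]; [left|right]; now apply arc_mirror. }
  destruct key as (rho & Hrho & key).
  unfold locally', within in Hphi.
  generalize (filter_and _ _ Hphi (locally_0_abs rho Hrho)); apply filter_imp.
  intros x [A Hx].
  destruct (Req_dec x 0) as [->|Hx0].
  - rewrite phi0, Rplus_0_r, Rabs_R0; lra.
  - apply key; auto.
    destruct (A Hx0); [left|right]; now apply forward_arc_arc with V.
Qed.

(** On the axis, Y = gamma x^(2k-1) X + O(x^(2k)). *)
Lemma contact_sign_on_axis (F : vfield) (k : nat) (gamma r M : R) :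
  (0 < k)%nat -> gamma <> 0 -> vx F 0 0 <> 0 -> 0 < r -> 0 <= M ->
  (forall x y, Rabs x <= r -> Rabs y <= r ->
    Rabs (vx F x y - vx F 0 0) <= Rabs (vx F 0 0) / 2 /\
    Rabs (vy F x y - gamma * x ^ (2 * k - 1) * vx F x y)
      <= M * (x ^ (2 * k) + Rabs y)) ->
  exists rho, 0 < rho /\
  forall x, 0 < x < rho -> 0 < vy F x 0 * (gamma * vx F 0 0).
Proof.
  intros Hk Hg HX0 Hr HM H; set (X0 := vx F 0 0) in *.
  assert (PX := Rabs_pos_lt _ HX0); assert (Pg := Rabs_pos_lt _ Hg).
  assert (PgX : 0 < Rabs gamma * (Rabs X0 / 2)) by (apply Rmult_lt_0_compat; lra).
  set (rho := Rmin r (Rabs gamma * (Rabs X0 / 2) / (M + 1))).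
  exists rho; split.
  { apply Rmin_pos; [exact Hr|]; apply Rdiv_lt_0_compat; lra. }
  intros x [x0 Hx].
  assert (x1 : x < r) by (eapply Rlt_le_trans; [exact Hx|apply Rmin_l]).
  assert (x2 : M * x < Rabs gamma * (Rabs X0 / 2)).
  { assert (x < Rabs gamma * (Rabs X0 / 2) / (M + 1))
      by (eapply Rlt_le_trans; [exact Hx|apply Rmin_r]).
    assert ((M + 1) * (Rabs gamma * (Rabs X0 / 2) / (M + 1)) =
      Rabs gamma * (Rabs X0 / 2)) by (field; lra). nra. }
  destruct (H x 0) as [HX HD]; rewrite ?Rabs_R0; try lra.
  { rewrite Rabs_pos_eq; lra. }
  rewrite Rabs_R0, Rplus_0_r in HD.
  set (p := (2 * k - 1)%nat) in *.
  replace (2 * k)%nat with (S p) in HD by (unfold p; lia).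
  assert (Pp : 0 < x ^ p) by now apply pow_lt.
  change (x ^ S p) with (x * x ^ p) in HD.
  apply Rabs_le_between in HX; apply Rabs_le_between in HD.
  set (W := vx F x 0) in *; set (Y := vy F x 0) in *.
  assert (HDp : gamma * W * x ^ p - M * x * x ^ p <= Y
    <= gamma * W * x ^ p + M * x * x ^ p) by lra.
  assert (W1 : 0 < W * X0 /\ Rabs X0 / 2 <= Rabs W).
  { destruct (Rlt_or_le 0 X0).
    - rewrite (Rabs_pos_eq X0) in * by lra.
      rewrite (Rabs_pos_eq W) by lra; nra.
    - rewrite (Rabs_left1 X0) in * by lra.
      rewrite (Rabs_left1 W) by lra; nra. }
  destruct W1 as [WX W2].
  assert (GW : M * x < Rabs (gamma * W)).
  { rewrite Rabs_mult.
    assert (Rabs gamma * (Rabs X0 / 2) <= Rabs gamma * Rabs W)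
      by (apply Rmult_le_compat_l; lra). lra. }
  assert (sq : 0 < (gamma * W) * (gamma * X0)).
  { replace (gamma * W * (gamma * X0)) with ((gamma * gamma) * (W * X0)) by ring.
    apply Rmult_lt_0_compat; [|exact WX]. now apply Rsqr_pos_lt. }
  destruct (Rlt_or_le 0 (gamma * W)) as [pos|neg].
  - rewrite Rabs_pos_eq in GW by lra.
    assert (0 < Y) by nra. assert (0 < gamma * X0) by nra. nra.
  - rewrite Rabs_left1 in GW by lra.
    assert (Y < 0) by nra. assert (gamma * X0 < 0) by nra. nra.
Qed.

(** For small x > 0, crossing at x says that gamma^+ X^+ and gamma^- X^- have the same
    sign, while invisibility from above and from below gives gamma^+ < 0 < gamma^-. *)
Lemma opposite_speeds (V : R * R -> Prop) (Zp Zm : vfield) (kp km : nat) :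
  open V -> V (0, 0) -> smooth_vfield_on V Zp -> smooth_vfield_on V Zm ->
  (0 < kp)%nat -> (0 < km)%nat ->
  monodromic_tangential_singularity V Zp Zm kp km ->
  vx Zp 0 0 * vx Zm 0 0 < 0.
Proof.
  intros V_open V_origin Sp Sm Hkp Hkm (Cp & Cm & P & _ & HP).
  destruct (invisible_contact_bounds V V_open V_origin Zp 1 kp Sp Hkp Cp)
    as (Xp & gp & rp & Mp & Hgp & Hrp & HMp & Hp).
  destruct (invisible_contact_bounds V V_open V_origin Zm (-1) km Sm Hkm Cm)
    as (Xm & gm & rm & Mm & Hgm & Hrm & HMm & Hm).
  destruct (contact_sign_on_axis Zp kp gp rp Mp) as (rho1 & H1 & S1); auto; try lra.
  destruct (contact_sign_on_axis Zm km gm rm Mm) as (rho2 & H2 & S2); auto; try lra.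
  destruct HP as [d Hd].
  set (x := Rmin d (Rmin rho1 rho2) / 2).
  assert (Pd := cond_pos d).
  assert (Px : 0 < Rmin d (Rmin rho1 rho2)) by (repeat apply Rmin_pos; lra).
  generalize (Rmin_l d (Rmin rho1 rho2)) (Rmin_r d (Rmin rho1 rho2))
    (Rmin_l rho1 rho2) (Rmin_r rho1 rho2); intros L1 L2 L3 L4.
  assert (Hx : 0 < x /\ x < d /\ x < rho1 /\ x < rho2) by (unfold x; lra).
  destruct (Hd x) as (x1 & Cr & _).
  { change (Rabs (x - 0) < d); rewrite Rminus_0_r, Rabs_pos_eq; lra. }
  { lra. }
  unfold crossing in Cr.
  assert (Q1 := S1 x ltac:(lra)); assert (Q2 := S2 x ltac:(lra)).
  assert (Q : 0 < (vy Zp x 0 * vy Zm x 0) *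
    ((- gp * gm) * - (vx Zp 0 0 * vx Zm 0 0))).
  { replace (vy Zp x 0 * vy Zm x 0 * (- gp * gm * - (vx Zp 0 0 * vx Zm 0 0)))
      with (vy Zp x 0 * (gp * vx Zp 0 0) * (vy Zm x 0 * (gm * vx Zm 0 0))) by ring.
    now apply Rmult_lt_0_compat. }
  assert (G : 0 < - gp * gm) by (apply Rmult_lt_0_compat; lra).
  apply Ropp_lt_cancel; rewrite Ropp_0.
  apply Rmult_lt_reg_l with (1 := G); rewrite Rmult_0_r.
  apply Rmult_lt_reg_l with (1 := Cr); rewrite Rmult_0_r; exact Q.
Qed.

(** * The period *)

(** The slope eta is bounded near the origin and the interval of integration has
    length O(x), so the graph of the solution stays within O(x) of the origin, where
    1/X is close to its value at the origin. *)
Lemma mean_inverse_speed (V : R * R -> Prop) (sg delta : R) (F : vfield)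
  (phi : R -> R) (y : R -> R -> R) :
  open V -> V (0, 0) -> smooth_vfield_on V F -> vx F 0 0 <> 0 ->
  Rabs (sg * delta) = 1 ->
  locally 0 (fun x => Rabs (phi x + x) <= 1 * Rabs x) ->
  eta_solution V sg delta F phi y ->
  forall eps, 0 < eps -> locally 0 (fun x =>
    Rabs (RInt (fun t => / vx F (x + (phi x - x) * t)
                             (y (sg * delta * (phi x - x) * t) x)) 0 1
          - / vx F 0 0) <= eps).
Proof.
  intros V_open V_origin [SX SY] HX0 Hsd Hphi Hy eps Heps.
  set (X0 := vx F 0 0) in *.
  assert (sd2 : (sg * delta) * (sg * delta) = 1).
  { assert (Rabs (sg * delta) * Rabs (sg * delta) = 1) by (rewrite Hsd; ring).
    rewrite <- Rabs_mult, Rabs_pos_eq in H; [exact H|apply Rle_0_sqr]. }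
  assert (CX := smooth_continuity V _ 0 0 SX V_origin).
  assert (CY := smooth_continuity V _ 0 0 SY V_origin).
  assert (CI := continuity_2d_pt_inv _ 0 0 CX HX0).
  destruct (CI (mkposreal eps Heps)) as [d1 H1].
  destruct (continuity_2d_pt_mult _ _ 0 0 CY CI (mkposreal 1 Rlt_0_1)) as [d2 H2].
  simpl in H1, H2; fold X0 in H1, H2.
  set (N := Rabs (vy F 0 0 * / X0) + 1) in *.
  set (r := Rmin d1 d2 / 2).
  assert (Hr : 0 < r /\ r < d1 /\ r < d2).
  { assert (0 < Rmin d1 d2) by (apply Rmin_pos; apply cond_pos).
    generalize (Rmin_l d1 d2) (Rmin_r d1 d2); unfold r; lra. }
  destruct Hr as (Hr & Hrd1 & Hrd2).
  assert (N1 : 1 <= N) by (generalize (Rabs_pos (vy F 0 0 * / X0)); unfold N; lra).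
  assert (Hd : 0 < r / (4 * N)) by (apply Rdiv_lt_0_compat; lra).
  generalize (filter_and _ _ Hy (filter_and _ _ Hphi (locally_0_abs _ Hd))).
  apply filter_imp; intros x (Hyx & Hpx & Hx); clear Hy Hphi.
  destruct Hyx as [y0 Hyx].
  set (th := phi x - x) in *.
  assert (Hth : Rabs th <= 3 * Rabs x).
  { unfold th; replace (phi x - x) with ((phi x + x) + (- 2 * x)) by ring.
    eapply Rle_trans; [apply Rabs_triang|].
    rewrite (Rabs_mult (-2)), (Rabs_left (-2)) by lra; lra. }
  assert (Hx4 : 4 * Rabs x * N < r).
  { assert (E : r / (4 * N) * (4 * N) = r) by (field; lra).
    rewrite <- E; replace (4 * Rabs x * N) with (Rabs x * (4 * N)) by ring.
    apply Rmult_lt_compat_r; lra. }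
  assert (Px := Rabs_pos x); assert (Pth := Rabs_pos th).
  assert (Hyx' : forall s, 0 <= s <= 1 ->
    V (x + th * s, y (sg * delta * th * s) x) /\
    vx F (x + th * s) (y (sg * delta * th * s) x) <> 0 /\
    is_derive (fun q => y q x) (sg * delta * th * s)
      (sg * delta * (vy F (x + th * s) (y (sg * delta * th * s) x) *
      / vx F (x + th * s) (y (sg * delta * th * s) x)))).
  { intros s Hs; generalize (Hyx s Hs); cbv zeta; unfold eta.
    replace (sg * delta * (sg * delta * th * s)) with (th * s)
      by (transitivity (sg * delta * (sg * delta) * (th * s));
        [rewrite sd2; ring|ring]).
    unfold Rdiv; now rewrite (Rmult_assoc (sg * delta) (vy F _ _)). }
  clear Hyx.
  (* The solution in the rescaled time s of the integral. *)
  set (w := fun s => y (sg * delta * th * s) x).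
  set (dw := fun s => th * (vy F (x + th * s) (w s) * / vx F (x + th * s) (w s))).
  assert (Dw : forall s, 0 <= s <= 1 -> is_derive w s (dw s)).
  { intros s Hs; destruct (Hyx' s Hs) as (_ & _ & D).
    replace (dw s) with (scal (sg * delta * th)
      (sg * delta * (vy F (x + th * s) (w s) * / vx F (x + th * s) (w s)))).
    - apply (is_derive_comp (fun q => y q x) (fun s => sg * delta * th * s)).
      + exact D.
      + auto_derive; [exact I|ring].
    - unfold scal; simpl; unfold mult; simpl; unfold dw.
      transitivity (sg * delta * (sg * delta) *
        (th * (vy F (x + th * s) (w s) * / vx F (x + th * s) (w s)))); [ring|].
      rewrite sd2; ring. }
  assert (Hxs : forall s, 0 <= s <= 1 -> Rabs (x + th * s) < r).
  { intros s Hs; eapply Rle_lt_trans; [apply Rabs_triang|].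
    rewrite Rabs_mult, (Rabs_pos_eq s) by lra. nra. }
  assert (w0 : w 0 = 0) by (unfold w; now rewrite Rmult_0_r).
  assert (Hw : forall s, 0 <= s <= 1 -> Rabs (w s) < r).
  { apply bootstrap_bound.
    - rewrite w0, Rabs_R0; exact Hr.
    - intros s Hs; apply (continuity_pt_comp w Rabs); [|apply Rcontinuity_abs].
      apply derivable_continuous_pt; exists (dw s).
      now apply is_derive_Reals, Dw.
    - intros s Hs Hbox.
      destruct (MVT_gen w 0 s dw) as (q & Hq & E);
        rewrite ?Rmin_left, ?Rmax_right in * by lra.
      + intros q Hq; apply Dw; lra.
      + intros q Hq; apply derivable_continuous_pt; exists (dw q).
        apply is_derive_Reals, Dw; lra.
      + rewrite w0, !Rminus_0_r in E; rewrite E.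
        assert (Hq1 : Rabs (x + th * q) < r) by (apply Hxs; lra).
        assert (Hq2 : Rabs (w q) <= r) by (apply Hbox; lra).
        assert (B : Rabs (vy F (x + th * q) (w q) * / vx F (x + th * q) (w q)) <= N).
        { generalize (H2 (x + th * q) (w q)); rewrite !Rminus_0_r; intros B.
          specialize (B ltac:(lra) ltac:(lra)).
          unfold N; set (z := _ * / vx F (x + th * q) (w q)) in *.
          replace z with ((z - vy F 0 0 * / X0) + vy F 0 0 * / X0) by ring.
          eapply Rle_trans; [apply Rabs_triang|]; lra. }
        unfold dw; rewrite !Rabs_mult, (Rabs_pos_eq s) by lra.
        rewrite <- Rabs_mult.
        assert (Rabs th * Rabs (vy F (x + th * q) (w q) * / vx F (x + th * q) (w q))
          <= 3 * Rabs x * N) by (apply Rmult_le_compat; auto using Rabs_pos).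
        assert (0 <= Rabs th * Rabs (vy F (x + th * q) (w q) * / vx F (x + th * q) (w q)))
          by (apply Rmult_le_pos; apply Rabs_pos).
        nra. }
  change (Rabs (RInt (fun t => / vx F (x + th * t) (w t)) 0 1 - / X0) <= eps).
  assert (Ex : ex_RInt (fun t => / vx F (x + th * t) (w t)) 0 1).
  { apply (ex_RInt_continuous (fun t => / vx F (x + th * t) (w t))).
    rewrite Rmin_left, Rmax_right by lra; intros s Hs.
    destruct (Hyx' s Hs) as (HV & Hnz & _); fold (w s) in HV, Hnz.
    apply (continuous_comp_2 (fun t => x + th * t) w (fun a b => / vx F a b)).
    - apply continuity_pt_filterlim; reg.
    - apply continuity_pt_filterlim, derivable_continuous_pt.
      exists (dw s); now apply is_derive_Reals, Dw.
    - apply (proj1 (continuity_2d_pt_filterlim (fun a b => / vx F a b) _ _)).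
      apply continuity_2d_pt_inv; [|exact Hnz].
      now apply smooth_continuity with V. }
  replace (RInt _ 0 1 - / X0) with
    (RInt (fun t => minus (/ vx F (x + th * t) (w t)) (/ X0)) 0 1).
  - replace eps with ((1 - 0) * eps) by ring.
    apply abs_RInt_le_const; [lra| |].
    + apply (ex_RInt_minus (fun t => / vx F (x + th * t) (w t)) (fun _ => / X0));
        [exact Ex|apply ex_RInt_const].
    + intros s Hs.
      generalize (H1 (x + th * s) (w s)); rewrite !Rminus_0_r; intros B.
      apply Rlt_le, B; generalize (Hxs s Hs) (Hw s Hs); lra.
  - eapply eq_trans; [apply (RInt_minus (fun t => / vx F (x + th * t) (w t))
      (fun _ => / X0)); [exact Ex|apply ex_RInt_const]|].
    rewrite RInt_const; unfold minus, plus, opp, scal; simpl.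
    unfold mult; simpl; ring.
Qed.

Lemma is_derive_T_half (V : R * R -> Prop) (sg delta : R) (F : vfield)
  (phi : R -> R) (y : R -> R -> R) :
  open V -> V (0, 0) -> smooth_vfield_on V F -> vx F 0 0 <> 0 ->
  Rabs (sg * delta) = 1 -> phi 0 = 0 ->
  (forall eps, 0 < eps -> locally 0 (fun x => Rabs (phi x + x) <= eps * Rabs x)) ->
  eta_solution V sg delta F phi y ->
  is_derive (T_half sg delta F phi y) 0 (- 2 / vx F 0 0).
Proof.
  intros V_open V_origin SF HX0 Hsd phi0 Hphi Hy.
  apply is_derive_at_0; [unfold T_half; rewrite phi0; ring|].
  intros eps Heps; set (X0 := vx F 0 0) in *.
  assert (PX := Rabs_pos_lt _ HX0).
  assert (I := mean_inverse_speed V sg delta F phi y V_open V_origin SF HX0 Hsd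
    (Hphi 1 Rlt_0_1) Hy (eps / 6) ltac:(lra)).
  assert (J := Hphi (eps * Rabs X0 / 2) ltac:(nra)).
  generalize (filter_and _ _ I (filter_and _ _ J (Hphi 1 Rlt_0_1))).
  apply filter_imp; intros x (Ix & Jx & Kx); unfold T_half; fold X0 in Ix.
  set (I0 := RInt _ 0 1) in *.
  replace ((phi x - x) * I0 - -2 / X0 * x) with
    ((phi x + x + - 2 * x) * (I0 - / X0) + (phi x + x) * / X0)
    by (field; exact HX0).
  eapply Rle_trans; [apply Rabs_triang|]; rewrite !Rabs_mult.
  assert (Px := Rabs_pos x).
  assert (B1 : Rabs (phi x + x + -2 * x) <= 3 * Rabs x).
  { eapply Rle_trans; [apply Rabs_triang|].
    rewrite (Rabs_mult (-2)), (Rabs_left (-2)) by lra; lra. }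
  assert (B2 : Rabs (phi x + x + -2 * x) * Rabs (I0 - / X0)
    <= 3 * Rabs x * (eps / 6)) by (apply Rmult_le_compat; auto using Rabs_pos).
  assert (B3 : Rabs (phi x + x) * Rabs (/ X0)
    <= eps * Rabs X0 / 2 * Rabs x * / Rabs X0).
  { rewrite Rabs_inv; apply Rmult_le_compat_r; [|exact Jx].
    now apply Rlt_le, Rinv_0_lt_compat. }
  replace (eps * Rabs X0 / 2 * Rabs x * / Rabs X0) with (eps / 2 * Rabs x) in B3
    by (field; lra).
  lra.
Qed.

Theorem corollary1
  (kp km : nat) (Hkp : (0 < kp)%nat) (Hkm : (0 < km)%nat)
  (V : R * R -> Prop) (V_open : open V) (V_origin : V (0, 0))
  (Zp Zm : vfield)
  (Zp_smooth : smooth_vfield_on V Zp) (Zm_smooth : smooth_vfield_on V Zm)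
  (center : tangential_center V Zp Zm kp km)
  (phi : R -> R)
  (phi_p : half_return_map V 1 Zp phi) (phi_m : half_return_map V (-1) Zm phi)
  (delta : R) (delta_def : delta = sign (vx Zp 0 0))
  (yp ym : R -> R -> R)
  (yp_sol : eta_solution V 1 delta Zp phi yp)
  (ym_sol : eta_solution V (-1) delta Zm phi ym) :
  let T := period delta Zp Zm phi yp ym in
  let T1 := 2 * delta * ((vx Zm 0 0 - vx Zp 0 0) / (vx Zp 0 0 * vx Zm 0 0)) in
  T 0 = 0 /\ is_derive T 0 T1 /\ T1 > 0.
Proof.
  intros T T1.
  assert (phi0 : phi 0 = 0) by apply phi_p.
  assert (XX := opposite_speeds V Zp Zm kp km V_open V_origin Zp_smooth Zm_smooth
    Hkp Hkm (proj1 center)).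
  assert (Hslope := half_return_slope V Zp kp phi V_open V_origin Zp_smooth Hkp
    (proj1 (proj1 center)) phi_p).
  set (Xp := vx Zp 0 0) in *; set (Xm := vx Zm 0 0) in *.
  assert (HXp : Xp <> 0) by (intros E; rewrite E in XX; lra).
  assert (HXm : Xm <> 0) by (intros E; rewrite E in XX; lra).
  assert (Hdelta : (delta = 1 /\ 0 < Xp /\ Xm < 0) \/
    (delta = -1 /\ Xp < 0 /\ 0 < Xm)).
  { destruct (Rlt_or_le 0 Xp) as [pos|neg].
    - left; rewrite delta_def, sign_eq_1 by exact pos; repeat split; nra.
    - right; rewrite delta_def, sign_eq_m1 by lra; repeat split; nra. }
  assert (Habs : forall sg, Rabs sg = 1 -> Rabs (sg * delta) = 1).
  { intros sg Hsg; rewrite Rabs_mult, Hsg, Rmult_1_l.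
    destruct Hdelta as [[-> _]|[-> _]]; [apply Rabs_R1|rewrite Rabs_left; lra]. }
  assert (Dp := is_derive_T_half V 1 delta Zp phi yp V_open V_origin Zp_smooth HXp
    (Habs 1 Rabs_R1) phi0 Hslope yp_sol).
  assert (Dm := is_derive_T_half V (-1) delta Zm phi ym V_open V_origin Zm_smooth
    HXm (Habs (-1) ltac:(rewrite Rabs_left; lra)) phi0 Hslope ym_sol).
  fold Xp in Dp; fold Xm in Dm.
  split; [|split].
  - unfold T, period, T_half; rewrite phi0; ring.
  - replace T1 with (delta * (-2 / Xm - -2 / Xp))
      by (unfold T1; field; split; assumption).
    apply (is_derive_scal (fun x => T_half (-1) delta Zm phi ym x
      - T_half 1 delta Zp phi yp x)).
    exact (is_derive_minus _ _ _ _ _ Dm Dp).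
  - assert (N : / (Xp * Xm) < 0) by now apply Rinv_lt_0_compat.
    unfold T1, Rdiv; destruct Hdelta as [(-> & ? & ?)|(-> & ? & ?)]; nra.
Qed.
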